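(* Let $\mathbf S=(S_1,S_2,S_3,\tilde S_1,\tilde S_2)$ be a $\Gamma_{E(3;2;1,2)}$-contraction on a Hilbert space $\mathcal H$ and let $\hat G_1,2\hat G_2,2\hat{\tilde G}_1,\hat{\tilde G}_2\in\mathcal B(\mathcal D_{S_3^*})$ be the fundamental operators of $\mathbf S^*=(S_1^*,S_2^*,S_3^*,\tilde S_1^*,\tilde S_2^* )$. Let $(M_D^{(1)},M_D^{(2)},M_D^{(3)},\tilde M_D^{(1)},\tilde M_D^{(2)})$ on $\mathcal Q_{S_3^*}$ be the canonical $\Gamma_{E(3;2;1,2)}$-unitary associated to $\mathbf S$, and let $\Pi_D^{\mathbf S}:\mathcal H\to H^2(\mathcal D_{S_3^*})\oplus\mathcal Q_{S_3^*}$ be the Douglas isometric embedding $$\Pi_D^{\mathbf S}h=\Big(\sum_{n\ge0}z^nD_{S_3^*}S_3^{*n}h,\ Q_{S_3^*}h\Big).$$ Put $\mathcal H_D^{\mathbf S}:=\operatorname{Ran}\Pi_D^{\mathbf S}$, and let $\mathbf W_D$ denote the $5$-tuple $$\big(M_{\hat G_1^*+\hat{\tilde G}_2z}\oplus M_D^{(1)},\ M_{2\hat G_2^*+2\hat{\tilde G}_1z}\oplus M_D^{(2)},\ M_z\oplus M_D^{(3)},\ M_{2\hat{\tilde G}_1^*+2\hat G_2z}\oplus\tilde M_D^{(1)},\ M_{\hat{\tilde G}_2^*+\hat G_1z}\oplus\tilde M_D^{(2)}\big)$$ on $H^2(\mathcal D_{S_3^*})\oplus\mathcal Q_{S_3^*}$.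 Then $\mathbf S$ is (simultaneously) unitarily equivalent to the compression $P_{\mathcal H_D^{\mathbf S}}\mathbf W_D|_{\mathcal H_D^{\mathbf S}}$. Moreover, when $\mathbf W_D$ is commutative, the operators satisfy $$[\hat G_1,\hat{\tilde G}_i]=0,\quad [\hat G_2,\hat{\tilde G}_j]=0\ (1\le i,j\le2),\quad [\hat G_1,\hat G_2]=[\hat{\tilde G}_1,\hat{\tilde G}_2]=0,$$ $$[\hat G_1,\hat G_1^*]=[\hat{\tilde G}_2,\hat{\tilde G}_2^*],\quad [\hat G_2,\hat G_2^*]=[\hat{\tilde G}_1,\hat{\tilde G}_1^*],\quad [\hat G_1,\hat{\tilde G}_1^*]=[\hat G_2,\hat{\tilde G}_2^*],$$ $$[\hat{\tilde G}_1,\hat G_1^*]=[\hat{\tilde G}_2,\hat G_2^*],\quad [\hat G_1,\hat G_2^*]=[\hat{\tilde G}_1,\hat{\tilde G}_2^*],\quad [\hat G_1^*,\hat G_2]=[\hat{\tilde G}_1^*,\hat{\tilde G}_2].$$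
   Context: Let $E=\{\operatorname{diag}(z_1,z_2,z_2):z_1,z_2\in\mathbb C\}\subset M_3(\mathbb C)$. For $A\in M_3(\mathbb C)$ put $\mu_E(A)=1/\inf\{\|X\|:X\in E,\ \det(I-AX)=0\}$ (operator norm), with $\mu_E(A)=0$ if $I-AX$ is nonsingular for all $X\in E$. $\Gamma_{E(3;2;1,2)}\subset\mathbb C^5$ is the set of all $(x_1,x_2,x_3,y_1,y_2)$ with $x_1=a_{11}$, $x_2=(a_{11}a_{22}-a_{12}a_{21})+(a_{11}a_{33}-a_{13}a_{31})$, $x_3=\det A$, $y_1=a_{22}+a_{33}$, $y_2=a_{22}a_{33}-a_{23}a_{32}$ for some $A=(a_{ij})\in M_3(\mathbb C)$ with $\mu_E(A)\le1$. Let $K_1=\{(x_1,x_2,x_3,y_1,y_2)\in\Gamma_{E(3;2;1,2)}: x_1=\bar y_2x_3,\ x_2=\bar y_1x_3,\ |x_3|=1\}$. A compact set $\Omega\subset\mathbb C^m$ is a spectral set for a commuting $m$-tuple $\mathbf T$ of bounded operators if the Taylor joint spectrum of $\mathbf T$ lies in $\Omega$ and $\|f(\mathbf T)\|\le\sup_\Omega|f|$ for every $f$ holomorphic in a neighbourhood of $\Omega$. A $\Gamma_{E(3;2;1,2)}$-contraction is a commuting $5$-tuple of bounded operators for which $\Gamma_{E(3;2;1,2)}$ is a spectral set (then $S_3$ is a contraction, and $\mathbf S^*$ is again a $\Gamma_{E(3;2;1,2)}$-contraction). A $\Gamma_{E(3;2;1,2)}$-unitary is a commuting $5$-tuple of normal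 operators whose Taylor joint spectrum is contained in $K_1$; a $\Gamma_{E(3;2;1,2)}$-isometry is the restriction of such a unitary to a joint invariant subspace. For a contraction $T$: $D_T=(I-T^*T)^{1/2}$, $\mathcal D_T=\overline{\operatorname{Ran}}\,D_T$. The fundamental operators of $\mathbf S^*$ are the (unique, by earlier work existing) operators $\hat G_1,2\hat G_2,2\hat{\tilde G}_1,\hat{\tilde G}_2\in\mathcal B(\mathcal D_{S_3^*})$ with $S_1^*-\tilde S_2S_3^*=D_{S_3^*}\hat G_1D_{S_3^*}$, $\tilde S_2^*-S_1S_3^*=D_{S_3^*}\hat{\tilde G}_2D_{S_3^*}$, $\tfrac{S_2^*}2-\tfrac{\tilde S_1}2S_3^*=D_{S_3^*}\hat G_2D_{S_3^*}$, $\tfrac{\tilde S_1^*}2-\tfrac{S_2}2S_3^*=D_{S_3^*}\hat{\tilde G}_1D_{S_3^*}$. Canonical $\Gamma_{E(3;2;1,2)}$-unitary associated to $\mathbf S$: let $Q_{S_3^*}\ge0$ be defined by $Q_{S_3^*}^2=\mathrm{SOT}\text{-}\lim_nS_3^nS_3^{*n}$, and define operators on $\overline{\operatorname{Ran}}\,Q_{S_3^*}$ by $W_{S_3^*}^{(i)*}Q_{S_3^*}h=Q_{S_3^*}S_i^*h$ ($1\le i\le3$) and $\tilde W_{S_3^*}^{(j)*}Q_{S_3^*}h=Q_{S_3^*}\tilde S_j^*h$ ($1\le j\le2$), $h\in\mathcal H$. These form a $\Gamma_{E(3;2;1,2)}$-isometry, with $W_{S_3^*}^{(3)*}$ an isometry.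 The canonical unitary is a $\Gamma_{E(3;2;1,2)}$-unitary $(M_D^{(1)},M_D^{(2)},M_D^{(3)},\tilde M_D^{(1)},\tilde M_D^{(2)})$ on a Hilbert space $\mathcal Q_{S_3^*}\supseteq\overline{\operatorname{Ran}}\,Q_{S_3^*}$ such that $M_D^{(i)*}$ extends $W_{S_3^*}^{(i)*}$, $\tilde M_D^{(j)*}$ extends $\tilde W_{S_3^*}^{(j)*}$, and $M_D^{(3)*}$ is the minimal unitary extension of $W_{S_3^*}^{(3)*}$, i.e. the linear span of $\{M_D^{(3)n}Q_{S_3^*}h:n\ge0,h\in\mathcal H\}$ is dense in $\mathcal Q_{S_3^*}$. $H^2(\mathcal E)$ is the $\mathcal E$-valued Hardy space on the unit disc, $M_\varphi$ is multiplication by $\varphi$ on it; $P_{\mathcal L}$ is orthogonal projection onto $\mathcal L$; $[X,Y]=XY-YX$. *)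

(* Defs.v *)
From HB Require Import structures.
From mathcomp Require Import all_boot all_order all_algebra.
From mathcomp Require Import all_classical all_reals all_analysis.
From mathcomp Require Import complex.
From mathcomp Require Import ring lra.
Set Implicit Arguments. Unset Strict Implicit. Unset Printing Implicit Defensive.
Import Order.TTheory GRing.Theory Num.Theory.
Import numFieldNormedType.Exports.
Local Open Scope classical_set_scope.
Local Open Scope ring_scope.
Local Open Scope complex_scope.

(* An inner product: linear in the first variable, conjugate-linear in the     *)
(* second.                                                                    *)
Definition inner_product {C : numClosedFieldType} {U : lmodType C}
    (f : U -> U -> C) : Prop :=
  [/\ forall a x y z, f (a *: x + y) z = a * f x z + f y z,
      forall x y, f x y = (f y x)^*%R &
      forall x, x != 0 -> 0 < f x x].

Section InnerProduct.
Context {C : numClosedFieldType} {U : lmodType C} (f : U -> U -> C).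
Hypothesis fP : inner_product f.

Lemma ipPl a x y z : f (a *: x + y) z = a * f x z + f y z.
Proof. by have [] := fP. Qed.

Lemma ipC x y : f x y = (f y x)^*%R.
Proof. by have [] := fP. Qed.

Lemma ip0l z : f 0 z = 0.
Proof. by have := ipPl (-1) 0 0 z; rewrite scaler0 addr0 mulN1r addNr. Qed.

Lemma ipDl x y z : f (x + y) z = f x z + f y z.
Proof. by have := ipPl 1 x y z; rewrite scale1r mul1r. Qed.

Lemma ipZl a x z : f (a *: x) z = a * f x z.
Proof. by have := ipPl a x 0 z; rewrite addr0 ip0l addr0. Qed.

Lemma ipNl x z : f (- x) z = - f x z.
Proof. by rewrite -scaleN1r ipZl mulN1r. Qed.

Lemma ip0r z : f z 0 = 0.
Proof. by rewrite ipC ip0l rmorph0. Qed.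

Lemma ipDr x y z : f x (y + z) = f x y + f x z.
Proof. by rewrite ipC ipDl rmorphD /= -!ipC. Qed.

Lemma ipZr a x y : f x (a *: y) = a^*%R * f x y.
Proof. by rewrite ipC ipZl rmorphM /= -ipC. Qed.

Lemma ipNr x y : f x (- y) = - f x y.
Proof. by rewrite ipC ipNl rmorphN /= -ipC. Qed.

Lemma ip_eq0 x : (f x x == 0) = (x == 0).
Proof.
have [->|x0] := eqVneq x 0; first by rewrite ip0l eqxx.
by have [_ _ /(_ x x0) h] := fP; rewrite gt_eqF.
Qed.

Lemma ip_ge0 x : 0 <= f x x.
Proof.
have [->|x0] := eqVneq x 0; first by rewrite ip0l.
by have [_ _ /(_ x x0) h] := fP; rewrite ltW.
Qed.

Lemma ip_CauchySchwarz x y : `|f x y| ^+ 2 <= f x x * f y y.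
Proof.
have [->|y0] := eqVneq y 0; first by rewrite !ip0r mulr0 normr0 expr0n.
have yp : 0 < f y y by rewrite lt_def ip_eq0 y0 ip_ge0.
have yJ : (f y y)^*%R = f y y by rewrite -ipC.
pose a := f x y / f y y.
have : 0 <= f (x - a *: y) (x - a *: y) by exact: ip_ge0.
rewrite ipDl !ipDr !ipNl !ipNr !ipZl !ipZr.
have -> : a * (a^*%R * f y y) = a * f y x.
  by rewrite /a rmorphM /= fmorphV /= yJ -ipC mulfVK ?gt_eqF.
rewrite opprK addNr addr0 subr_ge0.
rewrite [X in X <= _](_ : _ = `|f x y| ^+ 2 / f y y) ?ler_pdivrMr //.
by rewrite normCK /a rmorphM /= fmorphV /= yJ mulrAC [X in X / _]mulrC.
Qed.

Lemma ip_triangle x y :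
  sqrtC (f (x + y) (x + y)) <= sqrtC (f x x) + sqrtC (f y y).
Proof.
have n0 z : 0 <= sqrtC (f z z) by rewrite sqrtC_ge0 ip_ge0.
rewrite -(@ler_pXn2r _ 2) ?nnegrE ?addr_ge0 // sqrtCK sqrrD !sqrtCK.
rewrite ipDl !ipDr -!addrA lerD2l !addrA lerD2r.
rewrite (ipC y x).
have -> : f x y + (f x y)^*%R = 'Re (f x y) *+ 2.
  by rewrite -mulr_natr ReE mulfVK // pnatr_eq0.
rewrite lerMn2r /=; apply: le_trans (leif_Re_Creal _) _.
by rewrite -(@ler_pXn2r _ 2) ?nnegrE ?mulr_ge0 // exprMn !sqrtCK ip_CauchySchwarz.
Qed.

End InnerProduct.

HB.mixin Record CompleteNormedModule_isHilbert (R : realType) H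
    & CompleteNormedModule R[i] H := {
  inner : H -> H -> R[i];
  inner_productP : inner_product inner;
  norm_inner : forall x : H, `|x| ^+ 2 = inner x x
}.

#[short(type="hilbertType")]
HB.structure Definition Hilbert (R : realType) :=
  {H of CompleteNormedModule_isHilbert R H & CompleteNormedModule R[i] H}.

HB.factory Record Lmodule_isHilbert (R : realType) H & GRing.Lmodule R[i] H := {
  dot : H -> H -> R[i];
  dotP : inner_product dot;
  dot_complete : forall u : nat -> H,
    (forall e : R, 0 < e -> exists N, forall m n, (N <= m)%N -> (N <= n)%N ->
      complex.Re (dot (u m - u n) (u m - u n)) <= e ^+ 2) ->
    exists l, forall e : R, 0 < e -> exists N, forall n, (N <= n)%N ->
      complex.Re (dot (u n - l) (u n - l)) <= e ^+ 2
}.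

HB.builders Context (R : realType) H & Lmodule_isHilbert R H.

Let nrm (x : H) := sqrtC (dot x x).

Let nrmZ (a : R[i]) (x : H) : nrm (a *: x) = `|a| * nrm x.
Proof.
by rewrite /nrm (ipZl dotP) (ipZr dotP) mulrA -normCK rootCMl ?exprn_ge0 // sqrCK.
Qed.

Let nrm0 (x : H) : nrm x = 0 -> x = 0.
Proof. by move/eqP; rewrite sqrtC_eq0 (ip_eq0 dotP) => /eqP. Qed.

HB.instance Definition _ :=
  Lmodule_isNormed.Build R[i] H (ip_triangle dotP) nrmZ nrm0.

Let norm2 (x : H) : `|x| ^+ 2 = dot x x.
Proof. exact: sqrtCK. Qed.

Let nrm_le (x : H) (e : R) : 0 <= e -> (`|x| <= e%:C) = (complex.Re (dot x x) <= e ^+ 2).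
Proof.
move=> e0; rewrite -lecR RRe_real ?ger0_real ?ip_ge0 //; last exact: dotP.
rewrite -norm2 rmorphXn /= ler_pXn2r ?nnegrE ?normr_ge0 //.
by rewrite ler0c.
Qed.

Let complete (F : set_system H) : ProperFilter F -> cauchy F -> cvg F.
Proof.
move=> FF /cauchyP Fc.
have /choice [x Fx] : forall n, exists x, F (ball x (n.+1%:R^-1 : R)%:C).
  by move=> n; apply: Fc; rewrite ltcR invr_gt0 ltr0n.
have dist n m : (n <= m)%N -> `|x n - x m| <= (2 * n.+1%:R^-1 : R)%:C.
  move=> nm; have /filter_ex [y []] : F (ball (x n) (n.+1%:R^-1 : R)%:C `&`
     ball (x m) (m.+1%:R^-1 : R)%:C) by apply: filterI.
  rewrite -!ball_normE /= => h1 h2.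
  apply: (le_trans (ler_distD y _ _)); rewrite (distrC y).
  rewrite mulr2n mulrDl mul1r rmorphD lerD ?ltW //.
  apply: (lt_le_trans h2); rewrite lecR lef_pV2 ?posrE ?ltr0n // ler_nat.
  by rewrite ltnS.
have arch (e : R) : 0 < e -> exists n, n.+1%:R^-1 < e.
  move=> e0; exists (Num.truncn e^-1).
  by rewrite invf_plt ?posrE ?ltr0n // truncnS_gt.
have xdist (e : R) : 0 < e -> exists N, forall m n, (N <= m)%N -> (N <= n)%N ->
    `|x m - x n| <= e%:C.
  move=> e0; have [|N hN] := arch (e / 2); first by rewrite divr_gt0.
  exists N => m n; wlog mn : m n / (m <= n)%N => [hw Nm Nn|Nm Nn].
    by have /orP[mn|nm] := leq_total m n; [|rewrite distrC]; exact: hw.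
  apply: le_trans (dist _ _ mn) _; rewrite lecR -ler_pdivlMl // mulrC.
  apply: le_trans (ltW hN); rewrite lef_pV2 ?posrE ?ltr0n // ler_nat.
  by rewrite ltnS.
have [|l hl] := dot_complete (u := x).
  move=> e e0; have [N hN] := xdist _ e0; exists N => m n Nm Nn.
  by have := hN _ _ Nm Nn; rewrite nrm_le // ltW.
apply/cvg_ex; exists l; apply/cvgrPdist_lt => eps eps0.
have epsE : eps = (complex.Re eps)%:C by rewrite RRe_real // gtr0_real.
move: eps0; rewrite epsE ltcR; set e := complex.Re eps => e0.
have e20 : 0 < e / 2 by rewrite divr_gt0.
have [N1 h1] := arch _ e20.
have [N2 h2] := hl _ e20.
have [n [n1 n2]] : exists n, (N1 <= n)%N /\ (N2 <= n)%N.
  by exists (maxn N1 N2); rewrite leq_maxl leq_maxr.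
apply: filterS (Fx n) => y; rewrite -ball_normE /= => hy.
apply: le_lt_trans (ler_distD (x n) _ _) _.
rewrite [X in _ < X%:C]splitr rmorphD /= ler_ltD //.
  by rewrite distrC nrm_le ?h2 // ltW.
apply: (lt_trans hy); rewrite ltcR; apply: le_lt_trans h1.
by rewrite lef_pV2 ?posrE ?ltr0n // ler_nat ltnS.
Qed.

HB.instance Definition _ := Uniform_isComplete.Build H complete.
HB.instance Definition _ := CompleteNormedModule_isHilbert.Build R H dotP norm2.

HB.end.

Section Norm.
Context {R : realType} {H : hilbertType R}.
Implicit Types x y : H.

Definition hnorm x : R := complex.Re `|x|.

Lemma hnormE x : `|x| = (hnorm x)%:C.
Proof. by rewrite /hnorm RRe_real ?normr_real. Qed.

Lemma hnorm_ge0 x : 0 <= hnorm x.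
Proof. by rewrite -ler0c -hnormE. Qed.

Lemma hnormD x y : hnorm (x + y) <= hnorm x + hnorm y.
Proof. by rewrite -lecR rmorphD /= -!hnormE ler_normD. Qed.

Lemma hnormZ a x : hnorm (a *: x) = Normc.normc a * hnorm x.
Proof. apply: complexI; rewrite rmorphM /= -!hnormE normrZ. by []. Qed.

Lemma hnorm0 : hnorm (0 : H) = 0.
Proof. by rewrite /hnorm normr0. Qed.

Lemma hnorm_inner x : (hnorm x ^+ 2)%:C = inner x x.
Proof. by rewrite rmorphXn /= -hnormE norm_inner. Qed.

Lemma hnorm_Re x : hnorm x ^+ 2 = complex.Re (inner x x).
Proof. by rewrite -hnorm_inner. Qed.

Lemma hnorm_eq0 x : hnorm x = 0 -> x = 0.
Proof. by move=> h; apply/eqP; rewrite -normr_eq0 hnormE h. Qed.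

Lemma hcvgP (u : nat -> H) (l : H) :
  u @ \oo --> l <->
  forall e : R, 0 < e -> exists N, forall n, (N <= n)%N -> hnorm (u n - l) <= e.
Proof.
split=> [/cvgrPdist_le h e e0|h].
  have /h [N _ hN] : 0 < e%:C by rewrite ltcR.
  by exists N => n /hN /=; rewrite distrC hnormE lecR.
apply/cvgrPdist_le => e e0; have eE : e = (complex.Re e)%:C.
  by rewrite RRe_real // gtr0_real.
move: e0; rewrite eE ltcR => /h[N hN]; exists N => // n /= /hN.
by rewrite distrC hnormE lecR.
Qed.

Lemma hcomplete (u : nat -> H) :
  (forall e : R, 0 < e -> exists N, forall m n, (N <= m)%N -> (N <= n)%N ->
     hnorm (u m - u n) <= e) ->
  exists l : H, u @ \oo --> l.
Proof.
move=> h; suff /cvg_ex [l ?] : cvg (u @ \oo) by exists l.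
apply: cauchy_cvg; apply/cauchyP => e e0.
have eE : e = (complex.Re e)%:C by rewrite RRe_real // gtr0_real.
have e20 : 0 < complex.Re e / 2 by rewrite divr_gt0 // -ltcR -eE.
have [N hN] := h _ e20; exists (u N); exists N => // n /= Nn.
rewrite -ball_normE /= hnormE eE ltcR; apply: le_lt_trans (hN _ _ _ Nn) _ => //.
by rewrite ltr_pdivrMr // ltr_pMr ?ltr1n // -ltcR -eE.
Qed.

End Norm.

Section BoundedOperators.
Context {R : realType}.

Definition bounded_linear {H K : hilbertType R} (f : H -> K) : Prop :=
  linear f /\ exists M : R, forall x, hnorm (f x) <= M * hnorm x.

Definition bop_pred {H K : hilbertType R} : {pred (H -> K)} :=
  fun f => `[< bounded_linear f >].

Record bop (H K : hilbertType R) := Bop {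
  bop_fun :> H -> K;
  bop_subproof : bop_fun \in bop_pred
}.

Section Lmodule.
Variables H K : hilbertType R.

HB.instance Definition _ := [isSub of bop H K for @bop_fun H K].
HB.instance Definition _ := [Choice of bop H K by <:].

Lemma bop_closed : submod_closed (@bop_pred H K).
Proof.
split.
  apply/asboolP; split; first by move=> a x y; rewrite scaler0 addr0.
  by exists 0 => x; rewrite mul0r hnorm0.
move=> a f g /asboolP[fl [M hM]] /asboolP[gl [N hN]].
apply/asboolP; split.
  move=> b x y.
  change (a *: f (b *: x + y) + g (b *: x + y) =
    b *: (a *: f x + g x) + (a *: f y + g y)).
  by rewrite fl gl !scalerDr !scalerA (mulrC a) addrACA.
exists (Normc.normc a * M + N) => x; apply: le_trans (hnormD _ _) _.
rewrite hnormZ mulrDl lerD // -mulrA ler_wpM2l //.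
by rewrite -ler0c; exact: (normr_ge0 a).
Qed.

HB.instance Definition _ :=
  GRing.isSubmodClosed.Build R[i] (H -> K) (@bop_pred H K) bop_closed.
HB.instance Definition _ := [SubChoice_isSubLmodule of bop H K by <:].

Lemma bop_linear (T : bop H K) : linear T.
Proof. by case: T => f fb; have /asboolP[] := fb. Qed.

HB.instance Definition _ (T : bop H K) :=
  GRing.isLinear.Build R[i] H K *:%R T (bop_linear T).

Lemma bopP (S T : bop H K) : (forall x, S x = T x) -> S = T.
Proof. by move=> e; apply: val_inj; apply/funext. Qed.

End Lmodule.

Definition mkbop {H K : hilbertType R} {f : H -> K} (fb : bounded_linear f) :
  bop H K := Bop (introT (asboolP _) fb).

Lemma bop_bounded {H K : hilbertType R} (T : bop H K) :
  exists M : R, 0 <= M /\ forall x, hnorm (T x) <= M * hnorm x.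
Proof.
case: T => f fb; have /asboolP[_ [M hM]] := fb; exists `|M|; split=> // x.
by apply: le_trans (hM x) _; rewrite ler_wpM2r ?hnorm_ge0 // ler_norm.
Qed.

Lemma comp_bounded {H K L : hilbertType R} (S : bop K L) (T : bop H K) :
  bounded_linear (S \o T).
Proof.
split; first by move=> a x y /=; rewrite !linearP.
have [M [M0 hM]] := bop_bounded S; have [N [N0 hN]] := bop_bounded T.
exists (M * N) => x /=; apply: le_trans (hM _) _.
by rewrite -mulrA ler_wpM2l.
Qed.

Definition bcomp {H K L : hilbertType R} (S : bop K L) (T : bop H K) : bop H L :=
  mkbop (comp_bounded S T).

Lemma id_bounded (H : hilbertType R) : bounded_linear (@idfun H).
Proof. by split=> //; exists 1 => x; rewrite mul1r. Qed.

Section Ring.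
Variable H : hilbertType R.
Implicit Types S T U : bop H H.

Fact bmulA : associative (@bcomp H H H). Proof. by move=> S T U; exact: bopP. Qed.
Fact bmul1 : left_id (mkbop (@id_bounded H)) (@bcomp H H H).
Proof. by move=> S; exact: bopP. Qed.
Fact bmulr1 : right_id (mkbop (@id_bounded H)) (@bcomp H H H).
Proof. by move=> S; exact: bopP. Qed.
Fact bmulDl : left_distributive (@bcomp H H H) +%R.
Proof. by move=> S T U; exact: bopP. Qed.
Fact bmulDr : right_distributive (@bcomp H H H) +%R.
Proof. by move=> S T U; apply: bopP => x /=; exact: linearD. Qed.

HB.instance Definition _ := GRing.Zmodule_isPzRing.Build (bop H H)
  bmulA bmul1 bmulr1 bmulDl bmulDr.

End Ring.
End BoundedOperators.
Section ClosedSubspace.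
Context {R : realType} {H : hilbertType R}.

Record csubspace := CSubspace {
  cs_set :> set H;
  cs_0 : cs_set 0;
  cs_lin : forall (a : R[i]) x y, cs_set x -> cs_set y -> cs_set (a *: x + y);
  cs_closed : closed cs_set
}.

Definition cs_pred (V : csubspace) : {pred H} := fun x => `[< cs_set V x >].

Record csub (V : csubspace) := CSub {
  cs_val :> H;
  cs_valP : cs_val \in cs_pred V
}.

Variable V : csubspace.
HB.instance Definition _ := [isSub of csub V for @cs_val V].
HB.instance Definition _ := [Choice of csub V by <:].

Fact cs_submod : submod_closed (cs_pred V).
Proof.
split; first by apply/asboolP; exact: cs_0.
by move=> a x y /asboolP Vx /asboolP Vy; apply/asboolP; exact: cs_lin.
Qed.
HB.instance Definition _ :=
  GRing.isSubmodClosed.Build R[i] H (cs_pred V) cs_submod.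
HB.instance Definition _ := [SubChoice_isSubLmodule of csub V by <:].

Definition csub_inner (x y : csub V) : R[i] := inner (cs_val x) (cs_val y).

Fact csub_innerP : inner_product csub_inner.
Proof.
split=> [a x y z|x y|x x0]; rewrite /csub_inner.
- exact: (ipPl inner_productP).
- exact: (ipC inner_productP).
- rewrite lt_def (ip_ge0 inner_productP) (ip_eq0 inner_productP) andbT.
  by apply: contra x0 => /eqP e; apply/eqP; apply: val_inj.
Qed.

Fact csub_complete (u : nat -> csub V) :
  (forall e : R, 0 < e -> exists N, forall m n, (N <= m)%N -> (N <= n)%N ->
     complex.Re (csub_inner (u m - u n) (u m - u n)) <= e ^+ 2) ->
  exists l, forall e : R, 0 < e -> exists N, forall n, (N <= n)%N ->
     complex.Re (csub_inner (u n - l) (u n - l)) <= e ^+ 2.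
Proof.
move=> hu; pose v n := cs_val (u n).
have [|l hl] := @hcomplete R H v.
  move=> e e0; have [N hN] := hu _ e0; exists N => m n Nm Nn.
  have := hN _ _ Nm Nn; rewrite /csub_inner -hnorm_Re.
  by rewrite ler_pXn2r ?nnegrE ?hnorm_ge0 // ltW.
have Vl : cs_set V l.
  apply: (@closed_cvg nat H \oo _ v (cs_set V) (@cs_closed V) _ l hl).
  by apply: nearW => n; exact/asboolP/cs_valP.
exists (CSub (introT (asboolP _) Vl)) => e e0.
have [N hN] := (hcvgP v l).1 hl _ e0; exists N => n /hN.
by rewrite /csub_inner -hnorm_Re ler_pXn2r ?nnegrE ?hnorm_ge0 // ltW.
Qed.

HB.instance Definition _ :=
  Lmodule_isHilbert.Build R (csub V) csub_innerP csub_complete.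
End ClosedSubspace.
Arguments csubspace {R} H.

Section HilbertSum.
Context {R : realType}.

Definition hsum (H K : hilbertType R) : Type := (H * K)%type.

Variables H K : hilbertType R.
HB.instance Definition _ := GRing.Lmodule.copy (hsum H K) (H * K)%type.

Definition hsum_inner (x y : hsum H K) : R[i] :=
  inner x.1 y.1 + inner x.2 y.2.

Fact hsum_innerP : inner_product hsum_inner.
Proof.
have iP := @inner_productP R; rewrite /hsum_inner.
split=> [a x y z|x y|x x0] /=.
- by rewrite !(ipPl (iP _)) mulrDr addrACA.
- by rewrite (ipC (iP _)) [X in _ + X](ipC (iP _)) rmorphD.
- rewrite lt_def addr_ge0 ?(ip_ge0 (iP _)) // andbT.
  rewrite paddr_eq0 ?(ip_ge0 (iP _)) // !(ip_eq0 (iP _)).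
  by apply: contra x0 => /andP[/eqP e1 /eqP e2]; rewrite [x]surjective_pairing e1 e2.
Qed.

Fact hsum_complete (u : nat -> hsum H K) :
  (forall e : R, 0 < e -> exists N, forall m n, (N <= m)%N -> (N <= n)%N ->
     complex.Re (hsum_inner (u m - u n) (u m - u n)) <= e ^+ 2) ->
  exists l, forall e : R, 0 < e -> exists N, forall n, (N <= n)%N ->
     complex.Re (hsum_inner (u n - l) (u n - l)) <= e ^+ 2.
Proof.
move=> hu.
have E (x : hsum H K) : complex.Re (hsum_inner x x) = hnorm x.1 ^+ 2 + hnorm x.2 ^+ 2.
  by rewrite !hnorm_Re /hsum_inner; case: (inner _ _) (inner _ _) => [? ?] [].
have [|l1 /hcvgP hl1] := @hcomplete R H (fun n => (u n).1).
  move=> e e0; have [N hN] := hu _ e0; exists N => m n Nm Nn.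
  have := hN _ _ Nm Nn; rewrite E => h.
  rewrite -(@ler_pXn2r _ 2) ?nnegrE ?hnorm_ge0 ?(ltW e0) //.
  by apply: le_trans h; rewrite lerDl exprn_ge0 ?hnorm_ge0.
have [|l2 /hcvgP hl2] := @hcomplete R K (fun n => (u n).2).
  move=> e e0; have [N hN] := hu _ e0; exists N => m n Nm Nn.
  have := hN _ _ Nm Nn; rewrite E => h.
  rewrite -(@ler_pXn2r _ 2) ?nnegrE ?hnorm_ge0 ?(ltW e0) //.
  by apply: le_trans h; rewrite lerDr exprn_ge0 ?hnorm_ge0.
exists (l1, l2) => e e0; have e20 : 0 < e / 2 by rewrite divr_gt0.
have [N1 h1] := hl1 _ e20; have [N2 h2] := hl2 _ e20.
exists (maxn N1 N2) => n; rewrite geq_max => /andP[/h1 {}h1 /h2 {}h2].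
rewrite E /=; apply: le_trans (lerD (_ : _ <= (e / 2) ^+ 2) (_ : _ <= (e / 2) ^+ 2)) _.
- by rewrite ler_pXn2r ?nnegrE ?hnorm_ge0 ?(ltW e20).
- by rewrite ler_pXn2r ?nnegrE ?hnorm_ge0 ?(ltW e20).
by have := sqr_ge0 e; lra.
Qed.

HB.instance Definition _ :=
  Lmodule_isHilbert.Build R (hsum H K) hsum_innerP hsum_complete.
End HilbertSum.

Section ComplexSeries.
Context {R : realType}.
Implicit Types c d : nat -> R[i].

(* The sum of a series of complex numbers, through real and imaginary parts.   *)
Definition csum c : R[i] :=
  (limn (series (fun n => complex.Re (c n)))
   +i* limn (series (fun n => complex.Im (c n))))%C.

Definition csummable c : Prop :=
  cvgn (series (fun n => complex.Re (c n))) /\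
  cvgn (series (fun n => complex.Im (c n))).

Lemma csumP c x y : series (fun n => complex.Re (c n)) @ \oo --> x ->
  series (fun n => complex.Im (c n)) @ \oo --> y ->
  csummable c /\ csum c = (x +i* y)%C.
Proof.
move=> hx hy; split; first by split; [apply: cvgP hx|apply: cvgP hy].
by congr Complex; apply/cvg_lim.
Qed.

Lemma csum_lin a c d : csummable c -> csummable d ->
  csum (fun n => a * c n + d n) = a * csum c + csum d.
Proof.
move=> [c1 c2] [d1 d2]; case: a => a b.
have [||_ ->] := @csumP (fun n => (a +i* b)%C * c n + d n)
  (a * limn (series (fun n => complex.Re (c n))) +
   - b * limn (series (fun n => complex.Im (c n))) +
   limn (series (fun n => complex.Re (d n))))
  (a * limn (series (fun n => complex.Im (c n))) +
   b * limn (series (fun n => complex.Re (c n))) +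
   limn (series (fun n => complex.Im (d n)))).
- rewrite [series _](_ : _ = fun n =>
    a * series (fun n => complex.Re (c n)) n +
    - b * series (fun n => complex.Im (c n)) n + series (fun n => complex.Re (d n)) n).
    by apply: cvgD => //; apply: cvgD; apply: cvgMr.
  apply/funext => n; rewrite /series/= !mulr_sumr -!big_split /=.
  apply: eq_bigr => i _; case: (c i) (d i) => [? ?] [? ?] /=; ring.
- rewrite [series _](_ : _ = fun n =>
    a * series (fun n => complex.Im (c n)) n +
    b * series (fun n => complex.Re (c n)) n + series (fun n => complex.Im (d n)) n).
    by apply: cvgD => //; apply: cvgD; apply: cvgMr.
  apply/funext => n; rewrite /series/= !mulr_sumr -!big_split /=.
  apply: eq_bigr => i _; case: (c i) (d i) => [? ?] [? ?] /=; ring.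
rewrite /csum; apply/eqP; rewrite eq_complex /=.
by apply/andP; split; apply/eqP; ring.
Qed.

Lemma csum_conj c : csummable c -> csum (fun n => (c n)^*%R) = (csum c)^*%R.
Proof.
move=> [c1 c2].
have [||_ ->] := @csumP (fun n => (c n)^*%R)
  (limn (series (fun n => complex.Re (c n))))
  (- limn (series (fun n => complex.Im (c n)))); last by [].
- rewrite (_ : (fun n => _) = (fun n => complex.Re (c n))) //.
  by apply/funext => n; case: (c n).
- rewrite [series _](_ : _ = - series (fun n => complex.Im (c n))); first exact: cvgN.
  apply/funext => n; rewrite /series /= fctE -sumrN.
  by apply: eq_bigr => i _; case: (c i).
Qed.

End ComplexSeries.

Section Hardy.
Context {R : realType} {E : hilbertType R}.
Implicit Types a b : nat -> E.

Definition sqsummable a : Prop := cvgn (series (fun n => hnorm (a n) ^+ 2)).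

Lemma sqsummableP a : sqsummable a <->
  exists M : R, forall N, \sum_(n < N) hnorm (a n) ^+ 2 <= M.
Proof.
have nd : nondecreasing_seq (series (fun n => hnorm (a n) ^+ 2)).
  apply/nondecreasing_seqP => n; rewrite seriesSr lerDl exprn_ge0 ?hnorm_ge0 //.
split=> [h|[M hM]].
  exists (limn (series (fun n => hnorm (a n) ^+ 2))) => N.
  by have := nondecreasing_cvgn_le nd h N; rewrite /series /= big_mkord.
apply: nondecreasing_is_cvgn => //; exists M => _ [N _ <-].
by rewrite /series /= big_mkord.
Qed.

Lemma inner_bound (x y : E) : `|inner x y| <= (hnorm x ^+ 2 + hnorm y ^+ 2)%:C.
Proof.
have h := ip_CauchySchwarz (@inner_productP R E) x y.
have := hnorm_ge0 x; have := hnorm_ge0 y.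
move: h; rewrite -!hnorm_inner -rmorphM -exprMn rmorphXn /=.
rewrite ler_pXn2r ?nnegrE ?normr_ge0 //; last first.
  by rewrite ler0c mulr_ge0 ?hnorm_ge0.
move=> h y0 x0; apply: le_trans h _; rewrite lecR.
by have := sqr_ge0 (hnorm x - hnorm y); have := mulr_ge0 x0 y0; lra.
Qed.

Lemma Re_le_norm (z : R[i]) (e : R) : `|z| <= e%:C -> `|complex.Re z| <= e.
Proof. by move=> h; rewrite -lecR; apply: le_trans h; exact: normc_ge_Re. Qed.

Lemma Im_le_norm (z : R[i]) (e : R) : `|z| <= e%:C -> `|complex.Im z| <= e.
Proof.
move=> h; have := @Re_le_norm (z * 'i%C) e.
rewrite ReiNIm normrN; apply.
rewrite normrM (_ : `|'i%C| = 1) ?mulr1 //.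
by rewrite normc_def /= expr0n add0r expr1n sqrtr1.
Qed.

Lemma inner_summable a b : sqsummable a -> sqsummable b ->
  csummable (fun n => inner (a n) (b n)).
Proof.
move=> ha hb.
have hab : cvgn (series (fun n => hnorm (a n) ^+ 2 + hnorm (b n) ^+ 2)).
  exact: is_cvg_seriesD.
split; apply: normed_cvg; apply: (series_le_cvg _ _ _ hab) => n.
- exact: normr_ge0.
- exact: addr_ge0 (exprn_ge0 _ (hnorm_ge0 _)) (exprn_ge0 _ (hnorm_ge0 _)).
- exact: Re_le_norm (inner_bound _ _).
- exact: normr_ge0.
- exact: addr_ge0 (exprn_ge0 _ (hnorm_ge0 _)) (exprn_ge0 _ (hnorm_ge0 _)).
- exact: Im_le_norm (inner_bound _ _).
Qed.

Definition hardy_pred : {pred (nat -> E)} := fun a => `[< sqsummable a >].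

Lemma sqsummable_lin (k : R[i]) a b : sqsummable a -> sqsummable b ->
  sqsummable (fun n => k *: a n + b n).
Proof.
move=> /sqsummableP[M hM] /sqsummableP[N hN]; apply/sqsummableP.
pose c := Normc.normc k.
have c0 : 0 <= c by rewrite -ler0c; exact: (normr_ge0 k).
exists (2 * (c ^+ 2 * M + N)) => n.
apply: le_trans (_ : \sum_(i < n) 2 * (c ^+ 2 * hnorm (a i) ^+ 2 + hnorm (b i) ^+ 2) <= _).
  apply: ler_sum => i _; apply: le_trans (_ : (c * hnorm (a i) + hnorm (b i)) ^+ 2 <= _).
    rewrite ler_pXn2r ?nnegrE ?hnorm_ge0 ?addr_ge0 ?mulr_ge0 ?hnorm_ge0 //.
    by rewrite -hnormZ hnormD.
  by have := sqr_ge0 (c * hnorm (a i) - hnorm (b i)); lra.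
rewrite -mulr_sumr ler_pM2l ?ltr0n // big_split /= -mulr_sumr; apply: lerD; last exact: hN.
by apply: ler_wpM2l; rewrite ?exprn_ge0 ?hM.
Qed.

Lemma sqsummable0 : sqsummable (fun=> 0).
Proof.
by apply/sqsummableP; exists 0 => N; rewrite big1 // => i _; rewrite hnorm0 expr0n.
Qed.

Lemma hardy_submod : submod_closed hardy_pred.
Proof.
split; first by apply/asboolP; exact: sqsummable0.
move=> k a b /asboolP ha /asboolP hb; apply/asboolP; exact: sqsummable_lin.
Qed.

End Hardy.
Arguments hardy_pred {R} E.

(* The E-valued Hardy space of the unit disc: the element f(z) = sum_n z^n a_n *)
(* is represented by the square-summable sequence (a_n) of its Taylor          *)
(* coefficients, see heval_lim and Mlin_eval.                                   *)
Record hardy {R : realType} (E : hilbertType R) := Hardy {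
  hcoef :> nat -> E;
  hcoefP : hcoef \in hardy_pred E
}.

Section HardyHilbert.
Context {R : realType} (E : hilbertType R).

HB.instance Definition _ := [isSub of hardy E for @hcoef R E].
HB.instance Definition _ := [Choice of hardy E by <:].
HB.instance Definition _ :=
  GRing.isSubmodClosed.Build R[i] (nat -> E) (hardy_pred E) hardy_submod.
HB.instance Definition _ := [SubChoice_isSubLmodule of hardy E by <:].

Implicit Types f g : hardy E.

Lemma hardy_sqs f : sqsummable f. Proof. by case: f => a ap; apply/asboolP. Qed.

Definition mkhardy (a : nat -> E) (ha : sqsummable a) : hardy E :=
  Hardy (introT (asboolP _) ha : a \in hardy_pred E).

Lemma hardyP f g : (forall n, f n = g n) -> f = g.
Proof. by move=> e; apply: val_inj; apply/funext. Qed.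

Definition hardy_inner f g : R[i] := csum (fun n => inner (f n) (g n)).

Lemma hardy_inner_self f :
  hardy_inner f f = (limn (series (fun n => hnorm (f n) ^+ 2)))%:C.
Proof.
rewrite /hardy_inner.
have [||_ ->] := @csumP R (fun n => inner (f n) (f n))
  (limn (series (fun n => hnorm (f n) ^+ 2))) 0; last by [].
- rewrite (_ : (fun n => complex.Re _) = (fun n => hnorm (f n) ^+ 2)).
    exact: hardy_sqs.
  by apply/funext => n; rewrite hnorm_Re.
- rewrite (_ : series _ = fun=> 0); first exact: cvg_cst.
  apply/funext => n; rewrite /series /= big1 // => i _.
  by rewrite -hnorm_inner.
Qed.

Lemma hardy_inner_ge f N :
  \sum_(n < N) hnorm (f n) ^+ 2 <= complex.Re (hardy_inner f f).
Proof.
rewrite hardy_inner_self /=.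
have nd : nondecreasing_seq (series (fun n => hnorm (f n) ^+ 2)).
  apply/nondecreasing_seqP => n; rewrite seriesSr lerDl exprn_ge0 ?hnorm_ge0 //.
by have := nondecreasing_cvgn_le nd (@hardy_sqs f) N; rewrite /series /= big_mkord.
Qed.

Lemma hardy_inner_le f (e : R) :
  (forall N, \sum_(n < N) hnorm (f n) ^+ 2 <= e) ->
  complex.Re (hardy_inner f f) <= e.
Proof.
move=> h; rewrite hardy_inner_self /=; apply: limr_le; first exact: hardy_sqs.
by apply: nearW => N; rewrite /series /= big_mkord.
Qed.

Fact hardy_innerP : inner_product hardy_inner.
Proof.
split=> [k f g h|f g|f f0].
- rewrite /hardy_inner -csum_lin; [|exact/inner_summable/hardy_sqs/hardy_sqs..].
  by congr csum; apply/funext => n; rewrite -(ipPl inner_productP).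
- rewrite /hardy_inner -csum_conj; last exact/inner_summable/hardy_sqs/hardy_sqs.
  by congr csum; apply/funext => n; rewrite (ipC inner_productP).
- have [n fn0] : exists n, f n != 0.
    apply/not_existsP => h; case/negP: f0; apply/eqP/hardyP => n.
    by apply/eqP; apply/negPn/negP; exact: h.
  have := hardy_inner_ge f n.+1; rewrite hardy_inner_self ltcR /=.
  apply: lt_le_trans; rewrite big_ord_recr /= ltr_wpDl ?sumr_ge0 //.
    by move=> i _; rewrite exprn_ge0 ?hnorm_ge0.
  rewrite exprn_gt0 // lt_def hnorm_ge0 andbT.
  by apply: contra fn0 => /eqP/hnorm_eq0 ->.
Qed.

Fact hardy_complete (u : nat -> hardy E) :
  (forall e : R, 0 < e -> exists N, forall m n, (N <= m)%N -> (N <= n)%N ->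
     complex.Re (hardy_inner (u m - u n) (u m - u n)) <= e ^+ 2) ->
  exists l, forall e : R, 0 < e -> exists N, forall n, (N <= n)%N ->
     complex.Re (hardy_inner (u n - l) (u n - l)) <= e ^+ 2.
Proof.
move=> hu.
have /choice[l hl] : forall j, exists x : E, (fun k => u k j) @ \oo --> x.
  move=> j; apply: hcomplete => e e0; have [N hN] := hu _ e0.
  exists N => m n Nm Nn; have h := hN _ _ Nm Nn.
  rewrite -(@ler_pXn2r _ 2) ?nnegrE ?hnorm_ge0 ?(ltW e0) //.
  apply: le_trans h; apply: le_trans (hardy_inner_ge _ j.+1).
  by rewrite big_ord_recr /= lerDr sumr_ge0 // => i _; rewrite exprn_ge0 ?hnorm_ge0.
have hd (e : R) : 0 < e -> exists N, forall m, (N <= m)%N -> forall J,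
    \sum_(j < J) hnorm (u m j - l j) ^+ 2 <= e ^+ 2.
  move=> e0; have [N hN] := hu _ e0; exists N => m Nm J.
  have hc : (fun k => \sum_(j < J) hnorm (u m j - u k j) ^+ 2) @ \oo -->
      \sum_(j < J) hnorm (u m j - l j) ^+ 2.
    elim: J => [|j IH].
      by rewrite big_ord0; under eq_fun do rewrite big_ord0; exact: cvg_cst.
    rewrite big_ord_recr /=; under eq_fun do rewrite big_ord_recr /=.
    apply: cvgD => //; rewrite expr2; under eq_fun do rewrite expr2.
    suff hc : (fun k => hnorm (u m j - u k j)) @ \oo --> hnorm (u m j - l j).
      exact: cvgM.
    apply/cvgrPdist_le => d d0; have [K hK] := (hcvgP _ _).1 (hl j) _ d0.
    exists K => // k /= /hK; apply: le_trans.
    have t1 := hnormD (u m j - u k j) (u k j - l j).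
    have t2 := hnormD (u m j - l j) (l j - u k j).
    rewrite !addrA !subrK in t1 t2.
    have -> : hnorm (u k j - l j) = hnorm (l j - u k j) by rewrite /hnorm distrC.
    have e1 : hnorm (u k j - l j) = hnorm (l j - u k j) by rewrite /hnorm distrC.
    by rewrite ler_norml; apply/andP; split; lra.
  rewrite -(cvg_lim _ hc) //; apply: limr_le; first exact: cvgP hc.
  exists N => // k /= Nk; apply: le_trans (hN _ _ Nm Nk).
  exact: le_trans (hardy_inner_ge (u m - u k) J).
have [N1 h1] := hd 1 ltr01.
have ls : sqsummable l.
  have ds : sqsummable (fun j => u N1 j - l j).
    by apply/sqsummableP; exists (1 ^+ 2) => J; exact: h1.
  have := @sqsummable_lin R E (-1) _ _ ds (@hardy_sqs (u N1)).
  by congr sqsummable; apply/funext => j; rewrite scaleN1r opprB subrK.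
exists (mkhardy ls) => e e0; have [N hN] := hd _ e0; exists N => m Nm.
by apply: hardy_inner_le => J; exact: hN.
Qed.

HB.instance Definition _ :=
  Lmodule_isHilbert.Build R (hardy E) hardy_innerP hardy_complete.
End HardyHilbert.

Section Subspaces.
Context {R : realType}.

Lemma hnorm_csub (H : hilbertType R) (V : csubspace H) (x : csub V) :
  hnorm x = hnorm (cs_val x).
Proof.
apply/eqP; rewrite -(@eqrXn2 _ 2) ?hnorm_ge0 // !hnorm_Re; exact/eqP.
Qed.

Section Closure.
Variables H K : hilbertType R.
Variable T : bop H K.

Let rg : set K := closure (range T).

Fact clrange_0 : rg 0.
Proof. by apply: subset_closure; exists 0 => //; exact: linear0. Qed.

Fact clrange_lin (a : R[i]) x y : rg x -> rg y -> rg (a *: x + y).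
Proof.
move=> hx hy; pose f (p : K * K) := a *: p.1 + p.2.
have fc : {for (x, y), continuous f}.
  by apply: cvgD; [apply: cvgZr; exact: cvg_fst|exact: cvg_snd].
move=> B /fc [[B1 B2] /= [hB1 hB2] hB].
have [_ [[u _ <-] Bu]] := hx _ hB1; have [_ [[v _ <-] Bv]] := hy _ hB2.
exists (a *: T u + T v); split; last exact: (hB (T u, T v)).
by exists (a *: u + v) => //; rewrite linearP.
Qed.

Definition clrange : csubspace K :=
  CSubspace clrange_0 clrange_lin (@closed_closure _ (range T)).

Fact clrange_in x : T x \in cs_pred clrange.
Proof. by apply/asboolP; apply: subset_closure; exists x. Qed.

Fact cor_bounded :
  bounded_linear (fun x => CSub (clrange_in x)).
Proof.
split; first by move=> a x y; apply: val_inj; rewrite /= linearP.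
by have [M [_ hM]] := bop_bounded T; exists M => x; rewrite hnorm_csub; exact: hM.
Qed.

(* T, corestricted to the closure of its range.                               *)
Definition cor : bop H (csub clrange) := mkbop cor_bounded.

End Closure.

Section Inclusion.
Variables (H : hilbertType R) (V : csubspace H).
Fact incl_bounded : bounded_linear (@cs_val R H V).
Proof. by split=> //; exists 1 => x; rewrite mul1r hnorm_csub. Qed.
Definition incl : bop (csub V) H := mkbop incl_bounded.

(* The orthogonal projection onto V: x - P x is orthogonal to V for all x.     *)
Definition proj : bop H (csub V) :=
  xget 0 [set P : bop H (csub V) |
    forall (x : H) (v : csub V), inner (x - cs_val (P x)) (cs_val v) = 0].

Definition compression (W : bop H H) : bop (csub V) (csub V) :=
  bcomp proj (bcomp W incl).
End Inclusion.

(* [adj] and [proj] pick the operator with the characterizing property, which  *)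
(* exists and is unique by the Riesz and projection theorems.                 *)
Definition adj {H K : hilbertType R} (T : bop H K) : bop K H :=
  xget 0 [set S : bop K H | forall x y, inner (T x) y = inner x (S y)].

Definition isometric {H K : hilbertType R} (U : bop H K) : Prop :=
  forall x y, inner (U x) (U y) = inner x y.

Definition unitarily_equivalent {n} {H K : hilbertType R}
    (S : 'I_n -> bop H H) (T : 'I_n -> bop K K) : Prop :=
  exists U : bop H K, [/\ isometric U, range U = setT &
    forall i, bcomp U (S i) = bcomp (T i) U].

Section DirectSum.
Variables H K : hilbertType R.
Variables (S : bop H H) (T : bop K K).
Fact dsum_bounded :
  bounded_linear ((fun x => (S x.1, T x.2)) : hsum H K -> hsum H K).
Proof.
split.
  move=> a x y; rewrite [LHS]surjective_pairing [RHS]surjective_pairing /=.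
  by rewrite !linearP.
have [M [M0 hM]] := bop_bounded S; have [N [N0 hN]] := bop_bounded T.
exists (M + N) => x.
have E (y : hsum H K) : hnorm y ^+ 2 = hnorm y.1 ^+ 2 + hnorm y.2 ^+ 2.
  by rewrite !hnorm_Re /= -raddfD.
rewrite -(@ler_pXn2r _ 2) ?nnegrE ?hnorm_ge0 ?mulr_ge0 ?addr_ge0 ?hnorm_ge0 //.
rewrite exprMn !E /= mulrDr.
have aux (a b : R) : 0 <= a -> a <= b -> a ^+ 2 <= b ^+ 2.
  by move=> a0 ab; rewrite ler_pXn2r ?nnegrE // (le_trans a0).
apply: lerD.
- rewrite -exprMn; apply: aux (hnorm_ge0 _) _; apply: le_trans (hM _) _.
  by rewrite ler_wpM2r ?hnorm_ge0 // lerDl.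
- rewrite -exprMn; apply: aux (hnorm_ge0 _) _; apply: le_trans (hN _) _.
  by rewrite ler_wpM2r ?hnorm_ge0 // lerDr.
Qed.

Definition dsum : bop (hsum H K) (hsum H K) := mkbop dsum_bounded.
End DirectSum.
End Subspaces.

Section HardyOperators.
Context {R : realType} {E : hilbertType R}.

Lemma hardy_hnorm_ge (f : hardy E) N :
  \sum_(n < N) hnorm (f n) ^+ 2 <= hnorm f ^+ 2.
Proof. by rewrite [X in _ <= X]hnorm_Re; exact: hardy_inner_ge. Qed.

Lemma hardy_hnorm_le (f : hardy E) (e : R) : 0 <= e ->
  (forall N, \sum_(n < N) hnorm (f n) ^+ 2 <= e ^+ 2) -> hnorm f <= e.
Proof.
move=> e0 h; rewrite -(@ler_pXn2r _ 2) ?nnegrE ?hnorm_ge0 //.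
by rewrite [X in X <= _]hnorm_Re; exact: hardy_inner_le.
Qed.

Section Const.
Variable A : bop E E.

Fact hconst_le (f : hardy E) (M : R) N :
  0 <= M -> (forall x, hnorm (A x) <= M * hnorm x) ->
  \sum_(n < N) hnorm (A (f n)) ^+ 2 <= (M * hnorm f) ^+ 2.
Proof.
move=> M0 hM; rewrite exprMn.
apply: le_trans (ler_wpM2l _ (hardy_hnorm_ge f N)); last by rewrite exprn_ge0.
rewrite mulr_sumr; apply: ler_sum => n _; rewrite -exprMn.
by rewrite ler_pXn2r ?nnegrE ?mulr_ge0 ?hnorm_ge0.
Qed.

Fact hconst_sqs (f : hardy E) : sqsummable (fun n => A (f n)).
Proof.
have [M [M0 hM]] := bop_bounded A; apply/sqsummableP.
by exists ((M * hnorm f) ^+ 2) => N; exact: hconst_le.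
Qed.

Fact hconst_bounded : bounded_linear (fun f => mkhardy (@hconst_sqs f)).
Proof.
split; first by move=> a f g; apply: hardyP => n /=; exact: linearP.
have [M [M0 hM]] := bop_bounded A; exists M => f.
apply: hardy_hnorm_le; first by rewrite mulr_ge0 ?hnorm_ge0.
by move=> N; exact: hconst_le.
Qed.

(* Multiplication by the constant operator A.                                 *)
Definition Mconst : bop (hardy E) (hardy E) := mkbop hconst_bounded.
End Const.

Definition hshift_seq (a : nat -> E) (n : nat) : E :=
  if n is m.+1 then a m else 0.

Fact hshift_le (f : hardy E) N :
  \sum_(n < N) hnorm (hshift_seq f n) ^+ 2 <= (1 * hnorm f) ^+ 2.
Proof.
rewrite mul1r; case: N => [|N]; first by rewrite big_ord0 exprn_ge0 ?hnorm_ge0.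
rewrite big_ord_recl /= hnorm0 expr0n add0r; exact: hardy_hnorm_ge.
Qed.

Fact hshift_sqs (f : hardy E) : sqsummable (hshift_seq f).
Proof. by apply/sqsummableP; exists ((1 * hnorm f) ^+ 2) => N; exact: hshift_le. Qed.

Fact hshift_bounded : bounded_linear (fun f => mkhardy (@hshift_sqs f)).
Proof.
split.
  move=> a f g; apply: hardyP => -[|n] //.
  by change (0 = a *: 0 + 0 :> E); rewrite scaler0 addr0.
exists 1 => f; apply: hardy_hnorm_le; first by rewrite mul1r hnorm_ge0.
by move=> N; exact: hshift_le.
Qed.

(* Multiplication by the coordinate function z.                               *)
Definition Mz : bop (hardy E) (hardy E) := mkbop hshift_bounded.

(* Multiplication by the operator-valued function z |-> A + z B.              *)
Definition Mlin (A B : bop E E) : bop (hardy E) (hardy E) :=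
  Mconst A + Mz * Mconst B.

(* [heval_lim f z v] : the power series f converges at z, with sum v.         *)
Definition heval_lim (f : hardy E) (z : R[i]) (v : E) : Prop :=
  series (fun n => z ^+ n *: f n) @ \oo --> v.

Lemma bop_cvg {H K : hilbertType R} (T : bop H K) (u : nat -> H) (l : H) :
  u @ \oo --> l -> (fun n => T (u n)) @ \oo --> T l.
Proof.
move=> /hcvgP h; apply/hcvgP => e e0; have [M [M0 hM]] := bop_bounded T.
have M1 : 0 < M + 1 by rewrite ltr_wpDl.
have [N hN] := h (e / (M + 1)) (divr_gt0 e0 M1).
exists N => n /hN hn; rewrite -linearB; apply: le_trans (hM _) _.
apply: le_trans (_ : (M + 1) * hnorm (u n - l) <= _).
  by rewrite ler_wpM2r ?hnorm_ge0 // lerDl.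
by rewrite mulrC -ler_pdivlMr.
Qed.

Lemma Mlin_eval (A B : bop E E) (f : hardy E) (z : R[i]) (v : E) :
  heval_lim f z v -> heval_lim (Mlin A B f) z (A v + z *: B v).
Proof.
move=> h; rewrite /heval_lim -(cvg_shiftn 1).
have -> : (fun n => series (fun k => z ^+ k *: (Mlin A B f) k) (n + 1)%N) =
    fun n => A (series (fun k => z ^+ k *: f k) (n + 1)%N) +
             z *: B (series (fun k => z ^+ k *: f k) n).
  apply/funext => n; rewrite addn1 /series /= !big_mkord.
  rewrite (eq_bigr (fun k : 'I_n.+1 => z ^+ k *: A (f k) +
      z ^+ k *: hshift_seq (fun m => B (f m)) k)); last first.
    by move=> k _; rewrite -scalerDr; congr (_ *: (_ + _)); case: (nat_of_ord k).
  rewrite big_split /= linear_sum /=; congr (_ + _).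
    by apply: eq_bigr => k _; rewrite linearZ.
  rewrite big_ord_recl /= scaler0 add0r linear_sum scaler_sumr /=.
  by apply: eq_bigr => k _; rewrite linearZ scalerA -exprS.
move: h; rewrite /heval_lim; set s := series _ => h.
apply: (@cvgD _ E _ _ _ (fun n => A (s (n + 1)%N)) (fun n => z *: B (s n))).
  apply: (@bop_cvg E E A (fun n => s (n + 1)%N)).
  by rewrite (cvg_shiftn 1 s).
by apply: cvgZr; exact: (@bop_cvg E E B s).
Qed.

End HardyOperators.

Section TaylorSpectrum.
Context {R : realType}.

Definition Cn (n : nat) := 'rV[R[i]^o]_n.

Definition commuting_tuple {n} {H : hilbertType R} (T : 'I_n -> bop H H) : Prop :=
  forall i j, T i * T j = T j * T i.

Variables (n : nat) (H : hilbertType R) (T : 'I_n -> bop H H).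

(* The Koszul differential of T - z on H (x) /\ C^n.  An element of            *)
(* H (x) /\ C^n is a family xi_A, A a subset of 'I_n, standing for             *)
(* sum_A xi_A (x) e_A, and the differential is                                 *)
(*   x (x) e_A |-> sum_i (T_i - z_i) x (x) (e_i /\ e_A).                       *)
Definition koszul (z : Cn n) (xi : {set 'I_n} -> H) (A : {set 'I_n}) : H :=
  \sum_(i in A) (-1) ^+ #|[pred j in A | (j < i)%N]| *:
    (T i (xi (A :\ i)%SET) - z 0 i *: xi (A :\ i)%SET).

(* The differential raises the degree by one, so exactness in every degree is  *)
(* exactness on the total space.                                               *)
Definition koszul_exact (z : Cn n) : Prop :=
  forall xi : {set 'I_n} -> H, (forall A, koszul z xi A = 0) ->
    exists eta : {set 'I_n} -> H, forall A, xi A = koszul z eta A.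

Definition taylor_spectrum : set (Cn n) := [set z | ~ koszul_exact z].
End TaylorSpectrum.
Arguments Cn {R} n.

Section SpectralSet.
Context {R : realType}.

Definition opnorm {H K : hilbertType R} (T : bop H K) : R :=
  sup [set hnorm (T x) | x in [set x | hnorm x <= 1]].

Definition holomorphic {n} (U : set (Cn n)) (f : Cn n -> R[i]^o) : Prop :=
  forall z, U z -> differentiable f z.

(* Phi is the holomorphic functional calculus f |-> f(T) of the commuting     *)
(* tuple T on the open set U: the continuous unital algebra homomorphism on    *)
(* O(U) sending the coordinate functions to the T_i and satisfying the         *)
(* spectral mapping theorem.  By theorems of Taylor (existence) and Putinar    *)
(* (uniqueness) there is exactly one when U contains the Taylor spectrum.      *)
Record functional_calculus {n} {H : hilbertType R} (T : 'I_n -> bop H H)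
    (U : set (Cn n)) (Phi : (Cn n -> R[i]^o) -> bop H H) : Prop := {
  fc_lin : forall a f g, holomorphic U f -> holomorphic U g ->
    Phi (fun z => a * f z + g z) = a *: Phi f + Phi g;
  fc_mul : forall f g, holomorphic U f -> holomorphic U g ->
    Phi (fun z => f z * g z) = Phi f * Phi g;
  fc_one : Phi (fun=> 1) = 1;
  fc_coord : forall i, Phi (fun z => z 0 i) = T i;
  fc_cont : forall (f_ : nat -> Cn n -> R[i]^o) f,
    (forall k, holomorphic U (f_ k)) -> holomorphic U f ->
    (forall K, compact K -> K `<=` U -> {uniform K, f_ @ \oo --> f}) ->
    (fun k => opnorm (Phi (f_ k) - Phi f)) @ \oo --> (0 : R);
  fc_spectrum : forall m (f : 'I_m -> Cn n -> R[i]^o),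
    (forall j, holomorphic U (f j)) ->
    taylor_spectrum (fun j => Phi (f j)) =
      [set \row_j f j z | z in taylor_spectrum T]
}.

Definition spectral_set {n} {H : hilbertType R} (Omega : set (Cn n))
    (T : 'I_n -> bop H H) : Prop :=
  [/\ compact Omega, taylor_spectrum T `<=` Omega &
    forall U, open U -> Omega `<=` U ->
      exists2 Phi, functional_calculus T U Phi &
        forall f, holomorphic U f ->
          opnorm (Phi f) <= sup [set complex.Re `|f z| | z in Omega]].
End SpectralSet.

Section Gamma.
Context {R : realType}.
Local Notation C := R[i].

Definition E_space : set 'M[C]_3 :=
  [set X | exists z1 z2 : C, X = diag_mx (\row_j [:: z1; z2; z2]`_j)].

Definition vnorm {n} (v : 'cV[C]_n) : R :=
  Num.sqrt (\sum_i complex.Re `|v i 0| ^+ 2).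

Definition mxnorm {n} (X : 'M[C]_n) : R :=
  sup [set vnorm (X *m v) | v in [set v : 'cV[C]_n | vnorm v <= 1]].

Definition mu_E (A : 'M[C]_3) : R :=
  let sing := [set X | E_space X /\ \det (1%:M - A *m X) = 0] in
  if `[< sing !=set0 >] then (inf [set mxnorm X | X in sing])^-1 else 0.

(* (a, b, c, d, e) as a 5-tuple indexed by 'I_5.                              *)
Definition tup5 {T : Type} (a b c d e : T) (i : 'I_5) : T :=
  nth a [:: a; b; c; d; e] i.

(* Rows and columns are numbered from 0.                                       *)
Definition Gamma_point (A : 'M[C]_3) : Cn 5 :=
  \row_i tup5
    (A 0 0)
    ((A 0 0 * A 1 1 - A 0 1 * A 1 0) + (A 0 0 * A 2 2 - A 0 2 * A 2 0))
    (\det A)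
    (A 1 1 + A 2 2)
    (A 1 1 * A 2 2 - A 1 2 * A 2 1) i.

Definition Gamma : set (Cn 5) :=
  [set Gamma_point A | A in [set A | mu_E A <= 1]].

Definition K1 : set (Cn 5) :=
  [set p : Cn 5 | let x1 := p 0 0 in let x2 := p 0 1 in
     let x3 := p 0 2 in let y1 := p 0 3 in
     let y2 := p 0 4 in
     [/\ Gamma p, x1 = y2^*%C * x3, x2 = y1^*%C * x3 & `|x3| = 1]].

Definition Gamma_contraction {H : hilbertType R} (S : 'I_5 -> bop H H) : Prop :=
  commuting_tuple S /\ spectral_set Gamma S.

Definition normal_op {H : hilbertType R} (N : bop H H) : Prop :=
  N * adj N = adj N * N.

Definition Gamma_unitary {H : hilbertType R} (M : 'I_5 -> bop H H) : Prop :=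
  [/\ commuting_tuple M, forall i, normal_op (M i) & taylor_spectrum M `<=` K1].
End Gamma.

Section Model.
Context {R : realType}.

Definition positive_op {H : hilbertType R} (T : bop H H) : Prop :=
  forall x, 0 <= inner (T x) x.

(* D is the defect operator D_T = (I - T^* T)^(1/2).                           *)
Definition defect_operator {H : hilbertType R} (T D : bop H H) : Prop :=
  positive_op D /\ D * D = 1 - adj T * T.

(* Q >= 0 and Q^2 is the limit of T^n T^*n in the strong operator topology.     *)
Definition asymptotic_limit {H : hilbertType R} (T Q : bop H H) : Prop :=
  positive_op Q /\
  forall h, (fun n => (T ^+ n * adj T ^+ n) h) @ \oo --> (Q * Q) h.

Definition commutator {H : hilbertType R} (X Y : bop H H) : bop H H :=
  X * Y - Y * X.

(* D G D, as an operator on H, for G acting on the closure of the range of D.   *)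
Definition sandwich {H : hilbertType R} (D : bop H H)
    (G : bop (csub (clrange D)) (csub (clrange D))) : bop H H :=
  bcomp D (bcomp (incl _) (bcomp G (cor D))).

(* G1, 2 G2, 2 Gt1, Gt2 are the fundamental operators of (S1, .., St2)^*,     *)
(* where D is the defect operator of S3^*.                                    *)
Definition fundamental_operators {H : hilbertType R}
    (S1 S2 S3 St1 St2 D : bop H H)
    (G1 G2 Gt1 Gt2 : bop (csub (clrange D)) (csub (clrange D))) : Prop :=
  [/\ adj S1 - St2 * adj S3 = sandwich G1,
      adj St2 - S1 * adj S3 = sandwich Gt2,
      2^-1 *: adj S2 - (2^-1 *: St1) * adj S3 = sandwich G2 &
      2^-1 *: adj St1 - (2^-1 *: S2) * adj S3 = sandwich Gt1].

Definition lin_span {V : lmodType R[i]} (X : set V) : set V :=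
  [set x | exists (n : nat) (c : 'I_n -> R[i]) (v : 'I_n -> V),
     (forall i, X (v i)) /\ x = \sum_i c i *: v i].

(* M is the canonical unitary associated to S, on a Hilbert space QQ          *)
(* containing the closure of the range of Q through the embedding iota.         *)
Definition canonical_unitary {H QQ : hilbertType R} (S : 'I_5 -> bop H H)
    (Q : bop H H) (iota : bop (csub (clrange Q)) QQ) (M : 'I_5 -> bop QQ QQ)
    : Prop :=
  [/\ isometric iota, Gamma_unitary M,
      exists W : 'I_5 -> bop (csub (clrange Q)) (csub (clrange Q)),
        (forall i h, adj (W i) (cor Q h) = cor Q (adj (S i) h)) /\
        (forall i x, adj (M i) (iota x) = iota (adj (W i) x)) &
      closure (lin_span
        [set y | exists n h, y = (M 2 ^+ n) (iota (cor Q h))]) = setT].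

(* The element of the Hardy space with Taylor coefficients a (and 0 if a is     *)
(* not square-summable).                                                      *)
Definition hardy_of {E : hilbertType R} (a : nat -> E) : hardy E := insubd 0 a.

Definition douglas {H QQ : hilbertType R} (S3 D Q : bop H H)
    (iota : bop (csub (clrange Q)) QQ) (h : H) :
    hsum (hardy (csub (clrange D))) QQ :=
  (hardy_of (fun n => cor D ((adj S3 ^+ n) h)), iota (cor Q h)).
End Model.

(* Main.v *)
Require Import Defs.
From HB Require Import structures.
From mathcomp Require Import all_boot all_order all_algebra.
From mathcomp Require Import all_classical all_reals all_analysis.
From mathcomp Require Import complex.
From mathcomp Require Import ring lra.
Set Implicit Arguments. Unset Strict Implicit. Unset Printing Implicit Defensive.
Import Order.TTheory GRing.Theory Num.Theory.
Import numFieldNormedType.Exports.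
Local Open Scope classical_set_scope.
Local Open Scope ring_scope.

(** Write [T = S3], [D] for the defect operator of [T^*], and [P] for the
    Douglas embedding.

    The telescoping identity [|D x|^2 = |x|^2 - |T^* x|^2] gives
    [sum_(n < N) |D T^*n h|^2 = |h|^2 - |T^*N h|^2], and the last term tends to
    [|Q h|^2], so [P] is an isometry ([douglas_hnorm]) and its range is closed.

    Each entry [W] of the model tuple satisfies [W^* P = P S^*], where [S] is the
    corresponding entry of the given tuple. On the second summand this is the
    definition of the canonical unitary. On the Hardy space the adjoint of
    multiplication by [A + z B] has [A^* f_n + B^* f_(n+1)] as [n]-th
    coefficient ([adj_Mlin_coef]), so that, for the entries other than the shift,
    all reduces to [D S^* = F D + F'^* D T^*], where [F] and [F'] are the two
    fundamental operators attached to [S]; this follows from the fundamental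
    equations because [D] is injective on the closure of its range
    ([fundamental_intertwining]). An isometry that intertwines the adjoints in
    this way identifies [S] with the compression of [W] to its range
    ([coextension_compression]).

    If the model tuple commutes, so do the pencils [A + z B] on the Hardy space;
    comparing the coefficients of [1], [z] and [z^2] ([Mlin_comm]) and taking
    adjoints gives all the commutator identities.

    Adjoints of bounded operators exist by the Riesz representation theorem
    ([riesz]), and the orthogonal projection onto a closed subspace is the
    adjoint of the inclusion ([projP]). *)

(** * Hilbert space preliminaries *)

Lemma invS_small (R : realType) (e : R) :
  0 < e -> exists N, forall n, (N <= n)%N -> n.+1%:R^-1 <= e.
Proof.
move=> e0; exists (Num.truncn e^-1) => n Nn.
apply: (@le_trans _ _ ((Num.truncn e^-1).+1%:R^-1)).
  by rewrite lef_pV2 ?posrE ?ltr0n // ler_nat ltnS.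
by rewrite ltW // invf_plt ?posrE ?ltr0n // truncnS_gt.
Qed.

Section HilbertBasics.
Context {R : realType} {H : hilbertType R}.
Implicit Types x y z : H.
Local Notation iP := (@inner_productP R H).

Lemma innerDl x y z : inner (x + y) z = inner x z + inner y z.
Proof. exact: (ipDl iP). Qed.

Lemma innerDr x y z : inner z (x + y) = inner z x + inner z y.
Proof. exact: (ipDr iP). Qed.

Lemma innerNl x z : inner (- x) z = - inner x z.
Proof. exact: (ipNl iP). Qed.

Lemma innerNr x z : inner z (- x) = - inner z x.
Proof. exact: (ipNr iP). Qed.

Lemma innerBl x y z : inner (x - y) z = inner x z - inner y z.
Proof. by rewrite innerDl innerNl. Qed.

Lemma innerBr x y z : inner z (x - y) = inner z x - inner z y.
Proof. by rewrite innerDr innerNr. Qed.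

Lemma innerZl (a : R[i]) x z : inner (a *: x) z = a * inner x z.
Proof. exact: (ipZl iP). Qed.

Lemma innerZr (a : R[i]) x z : inner z (a *: x) = a^*%R * inner z x.
Proof. exact: (ipZr iP). Qed.

Lemma innerC x y : inner x y = (inner y x)^*%R.
Proof. exact: (ipC iP). Qed.

Lemma inner_eq0 x : inner x x = 0 -> x = 0.
Proof. by move=> /eqP; rewrite (ip_eq0 iP) => /eqP. Qed.

Lemma inner_extr x y : (forall z, inner z x = inner z y) -> x = y.
Proof.
move=> h; apply/eqP; rewrite -subr_eq0; apply/eqP/inner_eq0.
by rewrite innerBr h subrr.
Qed.

Lemma inner_extl x y : (forall z, inner x z = inner y z) -> x = y.
Proof. by move=> h; apply: inner_extr => z; rewrite innerC h -innerC. Qed.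

Lemma norm_inner_le x y : `|inner x y| <= (hnorm x * hnorm y)%:C%C.
Proof.
have h := ip_CauchySchwarz iP x y.
move: h; rewrite -!hnorm_inner -rmorphM -exprMn rmorphXn /=.
by rewrite ler_pXn2r ?nnegrE ?normr_ge0 // ler0c mulr_ge0 ?hnorm_ge0.
Qed.

Lemma Re_inner_le x y : `|complex.Re (inner x y)| <= hnorm x * hnorm y.
Proof. exact/Re_le_norm/norm_inner_le. Qed.

(** The conjugation of the closed field [R[i]] is the concrete one, which
    computes on real and imaginary parts. *)
Lemma conjCE (z : R[i]) : z^*%R = z^*%C.
Proof. by []. Qed.

Lemma hnormD_sqr x y :
  hnorm (x + y) ^+ 2 = hnorm x ^+ 2 + hnorm y ^+ 2 + 2 * complex.Re (inner x y).
Proof.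
rewrite !hnorm_Re !innerDl !innerDr (innerC y x).
case: (inner x x) (inner y y) (inner x y) => [a b] [c d] [e f].
rewrite conjCE /=; ring.
Qed.

Lemma hnorm_opp x : hnorm (- x) = hnorm x.
Proof. by rewrite /hnorm normrN. Qed.

Lemma complex_ReIm_eq (x y : R[i]) :
  complex.Re x = complex.Re y -> complex.Im x = complex.Im y -> x = y.
Proof. by case: x y => [a b] [c d] /= -> ->. Qed.

(** Riesz representation. The representing vector is the limit of a sequence
    [x n] minimizing [J x = |x|^2 - 2 Re (f x)]: the parallelogram law makes the
    sequence Cauchy, and comparing [J (x n)] with [J (x n + t y)] shows that
    [f y - inner y (x n)] tends to 0 for every [y]. *)
Lemma riesz (f : H -> R[i]) (M : R) :
  (forall (a : R[i]) x y, f (a *: x + y) = a * f x + f y) ->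
  (forall x, `|f x| <= (M * hnorm x)%:C%C) ->
  exists z, forall x, f x = inner x z.
Proof.
move=> fl fM.
pose J x := hnorm x ^+ 2 - 2 * complex.Re (f x).
have Jlb x : - M ^+ 2 <= J x.
  have := Re_le_norm (fM x); rewrite ler_norml => /andP[_ h].
  have := sqr_ge0 (hnorm x - M); rewrite /J; lra.
pose A := range J.
have Ainf : has_inf A.
  by split; [exists (J 0), 0|exists (- M ^+ 2) => _ [x _ <-]].
have Jge x : inf A <= J x by apply: ge_inf; [case: Ainf|exists x].
pose ep n : R := n.+1%:R^-1.
have ep0 n : 0 < ep n by rewrite invr_gt0 ltr0n.
have /choice[x hx] n : exists x, J x < inf A + ep n.
  by have [_ [x _ <-] h] := inf_adherent (ep0 n) Ainf; exists x.
have arch (e : R) : 0 < e -> exists N, forall n, (N <= n)%N -> ep n <= e.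
  exact: invS_small.
have par u v : hnorm (u - v) ^+ 2 =
    2 * (J u + J v) - 4 * J (2^-1 *: (u + v)).
  rewrite /J -[2^-1 *: _]addr0 fl -[u]scale1r fl scale1r.
  have f0 : f 0 = 0 by have := fl (-1) 0 0; rewrite scaler0 addr0 mulN1r addNr.
  rewrite addr0 f0 addr0 hnormZ exprMn !hnormD_sqr hnorm_opp innerNr.
  have -> : (2^-1 : R[i]) = (2^-1 : R)%:C%C by rewrite fmorphV rmorph_nat.
  have -> : Normc.normc (2^-1 : R)%:C%C = 2^-1 :> R.
    by rewrite /= expr0n /= addr0 sqrtr_sqr ger0_norm // invr_ge0 ler0n.
  case: (f u) (f v) (inner u v) => [a b] [c d] [e g] /=; lra.
have [l hl] : exists l : H, x @ \oo --> l.
  apply: hcomplete => e e0.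
  have [|N hN] := arch (e ^+ 2 / 4); first by rewrite divr_gt0 // exprn_gt0.
  exists N => m n /hN Nm /hN Nn.
  rewrite -(@ler_pXn2r _ 2) ?nnegrE ?hnorm_ge0 ?(ltW e0) // par.
  have := hx m; have := hx n; have := Jge (2^-1 *: (x m + x n)); lra.
exists l => y; apply/eqP; rewrite -subr_eq0 -normr_le0.
pose g n := f y - inner y (x n).
have gle n : complex.Re (`|g n| ^+ 2) <= ep n * (1 + hnorm y ^+ 2).
  pose s : R := (1 + hnorm y ^+ 2)^-1.
  have s1 : 0 < 1 + hnorm y ^+ 2 by rewrite ltr_wpDr ?exprn_ge0 ?hnorm_ge0.
  have s0 : 0 < s by rewrite invr_gt0.
  (* near-minimality of x n along t y bounds g n when t is a multiple of its
     conjugate; this s makes the quadratic term harmless *)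
  pose t : R[i] := s%:C%C * (g n)^*%R.
  have E : J (t *: y + x n) = J (x n) +
      complex.Re (`|g n| ^+ 2) * (s ^+ 2 * hnorm y ^+ 2 - 2 * s).
    rewrite /J fl hnormD_sqr innerZl normCK.
    have -> : hnorm (t *: y) ^+ 2 =
        s ^+ 2 * complex.Re (g n * (g n)^*%R) * hnorm y ^+ 2.
      rewrite !hnorm_Re innerZl innerZr -hnorm_inner /t.
      by case: (g n) => a b; rewrite !conjCE /=; ring.
    rewrite /t.
    have -> : inner y (x n) = f y - g n by rewrite /g opprB addrC subrK.
    case: (g n) (f y) (f (x n)) => [a b] [c d] [k m]; rewrite !conjCE /=; ring.
  have h1 : s * (1 + hnorm y ^+ 2) = 1 by rewrite mulVf ?gt_eqF.
  have h2 : s ^+ 2 * hnorm y ^+ 2 - 2 * s <= - s.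
    have -> : s ^+ 2 * hnorm y ^+ 2 = s - s ^+ 2.
      by rewrite expr2 -{3}(mulr1 s) -h1; ring.
    by have := sqr_ge0 s; lra.
  have g0 : 0 <= complex.Re (`|g n| ^+ 2).
    by rewrite -lecR RRe_real ?exprn_ge0 // ger0_real ?exprn_ge0.
  have := Jge (t *: y + x n); rewrite E => h3.
  have h4 := ler_wpM2l g0 h2.
  have h5 : complex.Re (`|g n| ^+ 2) * s <= ep n by have := hx n; lra.
  by rewrite -ler_pdivrMr.
apply/ler_addgt0Pl => e e0; rewrite addr0.
have eE : e = (complex.Re e)%:C%C by rewrite RRe_real // gtr0_real.
move: e0; rewrite eE ltcR; set e' := complex.Re e => e0.
have e20 : 0 < e' / 2 by rewrite divr_gt0.
have k0 : 0 < 1 + hnorm y ^+ 2 by rewrite ltr_wpDr ?exprn_ge0 ?hnorm_ge0.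
have [|N1 hN1] := arch ((e' / 2) ^+ 2 / (1 + hnorm y ^+ 2)).
  by rewrite divr_gt0 // exprn_gt0.
have y1 : 0 < hnorm y + 1 by rewrite ltr_wpDl ?hnorm_ge0.
have [N2 hN2] := (hcvgP _ _).1 hl (e' / 2 / (hnorm y + 1)) (divr_gt0 e20 y1).
pose n := maxn N1 N2.
have -> : f y - inner y l = g n + inner y (x n - l).
  by rewrite /g innerBr addrA subrK.
apply: le_trans (ler_normD _ _) _.
rewrite [X in _ <= X%:C%C]splitr rmorphD /=; apply: lerD.
  rewrite -(@ler_pXn2r _ 2) ?nnegrE ?normr_ge0 ?ler0c ?(ltW e20) //.
  rewrite -[X in X <= _]RRe_real ?ger0_real ?exprn_ge0 //.
  rewrite -[X in _ <= X]rmorphXn lecR.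
  apply: le_trans (gle n) _; rewrite -ler_pdivlMr //.
  by apply: hN1; exact: leq_maxl.
apply: le_trans (norm_inner_le _ _) _; rewrite lecR.
apply: le_trans (_ : (hnorm y + 1) * hnorm (x n - l) <= _).
  by rewrite ler_wpM2r ?hnorm_ge0 // lerDl.
by rewrite mulrC -ler_pdivlMr // hN2 // leq_maxr.
Qed.

End HilbertBasics.

(** * Adjoints *)

Section Adjoint.
Context {R : realType}.

Lemma adj_exists (H K : hilbertType R) (T : bop H K) :
  exists S : bop K H, forall x y, inner (T x) y = inner x (S y).
Proof.
have [M [M0 hM]] := bop_bounded T.
have /choice[S hS] y : exists z : H, forall x, inner (T x) y = inner x z.
  apply: (@riesz _ _ (fun x => inner (T x) y) (M * hnorm y)).
    by move=> a x z; rewrite linearP innerDl innerZl.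
  move=> x; apply: le_trans (norm_inner_le _ _) _; rewrite lecR.
  by rewrite mulrAC ler_wpM2r ?hnorm_ge0.
have Sb : bounded_linear S.
  split.
    move=> a y z; apply: inner_extr => x.
    by rewrite -hS !innerDr !innerZr !hS.
  exists M => y.
  have := Re_inner_le (T (S y)) y; rewrite hS -hnorm_Re.
  have [->|n0] := eqVneq (hnorm (S y)) 0; first by rewrite mulr_ge0 ?hnorm_ge0.
  have np : 0 < hnorm (S y) by rewrite lt_def n0 hnorm_ge0.
  move=> /(le_trans (ler_norm _)) h.
  have h2 := ler_wpM2r (hnorm_ge0 y) (hM (S y)).
  rewrite -(ler_pM2l np) -expr2; apply: le_trans h _.
  by apply: le_trans h2 _; rewrite mulrCA mulrA mulrAC.
by exists (mkbop Sb).
Qed.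

Lemma adjP (H K : hilbertType R) (T : bop H K) x y :
  inner (T x) y = inner x (adj T y).
Proof.
rewrite /adj; have [S hS] := adj_exists T.
by case: xgetP => [S' _ h|/(_ S) []//]; exact: h.
Qed.

Lemma adj_innerl (H K : hilbertType R) (T : bop H K) x y :
  inner (adj T y) x = inner y (T x).
Proof. by rewrite innerC -adjP -innerC. Qed.

Lemma adj_unique (H K : hilbertType R) (T : bop H K) (S : bop K H) :
  (forall x y, inner (T x) y = inner x (S y)) -> adj T = S.
Proof.
by move=> h; apply: bopP => y; apply: inner_extr => x; rewrite -adjP h.
Qed.

Lemma adjK (H K : hilbertType R) (T : bop H K) : adj (adj T) = T.
Proof. by apply: adj_unique => x y; rewrite adj_innerl. Qed.

Lemma adj_bcomp (H K L : hilbertType R) (S : bop K L) (T : bop H K) :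
  adj (bcomp S T) = bcomp (adj T) (adj S).
Proof. by apply: adj_unique => x y /=; rewrite !adjP. Qed.

Section Endo.
Variable H : hilbertType R.
Implicit Types S T : bop H H.

Lemma bop_mulE S T x : (S * T) x = S (T x). Proof. by []. Qed.
Lemma bop_addE S T x : (S + T) x = S x + T x. Proof. by []. Qed.
Lemma bop_oppE S x : (- S) x = - S x. Proof. by []. Qed.
Lemma bop_subE S T x : (S - T) x = S x - T x. Proof. by []. Qed.
Lemma bop_scaleE (a : R[i]) S x : (a *: S) x = a *: S x. Proof. by []. Qed.

Lemma adjM S T : adj (S * T) = adj T * adj S.
Proof. exact: adj_bcomp. Qed.

Lemma adjD S T : adj (S + T) = adj S + adj T.
Proof. by apply: adj_unique => x y; rewrite !bop_addE innerDl innerDr !adjP. Qed.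

Lemma adjN S : adj (- S) = - adj S.
Proof. by apply: adj_unique => x y; rewrite !bop_oppE innerNl innerNr !adjP. Qed.

Lemma adjB S T : adj (S - T) = adj S - adj T.
Proof. by rewrite adjD adjN. Qed.

Lemma adjZ (a : R[i]) S : adj (a *: S) = a^*%R *: adj S.
Proof.
by apply: adj_unique => x y; rewrite !bop_scaleE innerZl innerZr conjCK adjP.
Qed.

Lemma adj_inj S T : adj S = adj T -> S = T.
Proof. by move=> h; rewrite -[S]adjK h adjK. Qed.

Lemma positive_op_selfadj S : positive_op S -> adj S = S.
Proof.
move=> h.
have re x : inner (S x) x = inner x (S x).
  by rewrite [RHS]innerC; apply/esym/CrealP/ger0_real/h.
(* polarization of the real quadratic form x |-> inner (S x) x *)
have im x y : complex.Im (inner (S x) y) = complex.Im (inner x (S y)).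
  have := re (x + y); rewrite !linearD /= !innerDl !innerDr !re.
  rewrite (innerC (S y) x) (innerC y (S x)).
  case: (inner (S x) y) (inner x (S y)) (inner x (S x)) (inner y (S y))
    => [a b] [c d] [e f] [k m].
  by rewrite !conjCE => -[_] /=; lra.
apply: adj_unique => x y; apply: complex_ReIm_eq (im x y).
have := im x ('i%C *: y); rewrite linearZ /= !innerZr.
case: (inner (S x) y) (inner x (S y)) => [a b] [c d].
by rewrite !conjCE /=; lra.
Qed.

End Endo.
End Adjoint.

(** * Isometries, projections and compressions *)

Section Isometries.
Context {R : realType}.

Lemma closure_hnorm (H : hilbertType R) (A : set H) (y : H) :
  closure A y -> forall e : R, 0 < e -> exists2 z, A z & hnorm (z - y) <= e.
Proof.
move=> Ay e e0.
have e0' : 0 < e%:C%C by rewrite ltcR.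
have [z [Az]] := Ay _ (nbhsx_ballx y _ e0').
rewrite -ball_normE /= hnormE ltcR => h; exists z => //.
by rewrite /hnorm distrC ltW.
Qed.

Lemma hnorm_le0 (H : hilbertType R) (x : H) :
  (forall e : R, 0 < e -> hnorm x <= e) -> x = 0.
Proof.
move=> h; apply/hnorm_eq0/le_anti; rewrite hnorm_ge0 andbT.
by apply/ler_addgt0Pl => e e0; rewrite addr0 h.
Qed.

Lemma hsum_hnormE (H K : hilbertType R) (y : hsum H K) :
  hnorm y ^+ 2 = hnorm y.1 ^+ 2 + hnorm y.2 ^+ 2.
Proof. by rewrite !hnorm_Re /= -raddfD. Qed.

Lemma isometric_hnorm (H K : hilbertType R) (U : bop H K) x :
  isometric U -> hnorm (U x) = hnorm x.
Proof.
by move=> h; apply/eqP; rewrite -(@eqrXn2 _ 2) ?hnorm_ge0 // !hnorm_Re h.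
Qed.

Lemma hnorm_isometric (H K : hilbertType R) (U : bop H K) :
  (forall x, hnorm (U x) = hnorm x) -> isometric U.
Proof.
move=> h.
have re x y : complex.Re (inner (U x) (U y)) = complex.Re (inner x y).
  have := congr1 (fun r => r ^+ 2) (h (x + y)).
  by rewrite linearD !hnormD_sqr !h; lra.
move=> x y; apply: complex_ReIm_eq (re x y) _.
have := re x ('i%C *: y); rewrite linearZ /= !innerZr.
case: (inner _ _) (inner x y) => [a b] [c d].
by rewrite !conjCE /=; lra.
Qed.

Lemma isometric_range_closed (H K : hilbertType R) (U : bop H K) :
  isometric U -> closed (range U).
Proof.
move=> hU y Uy.
have /choice[g hg] n : exists g, hnorm (U g - y) <= (n.+1%:R^-1 : R).
  have n0 : 0 < (n.+1%:R^-1 : R) by rewrite invr_gt0 ltr0n.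
  by have [_ [g _ <-]] := closure_hnorm Uy n0; exists g.
have gU : (fun n => U (g n)) @ \oo --> y.
  apply/hcvgP => e e0; have [N hN] := invS_small e0.
  by exists N => n /hN; exact: le_trans.
have [l hl] : exists l : H, g @ \oo --> l.
  apply: hcomplete => e e0; have e20 : 0 < e / 2 by rewrite divr_gt0.
  have [N hN] := (hcvgP _ _).1 gU _ e20; exists N => m n /hN Nm /hN Nn.
  rewrite -(isometric_hnorm _ hU) linearB.
  have := Defs.hnormD (U (g m) - y) (y - U (g n)); rewrite addrA subrK.
  by rewrite [hnorm (y - _)]/hnorm distrC -/(hnorm _); lra.
exists l => //; apply: cvg_unique gU; first exact: norm_hausdorff.
exact: bop_cvg.
Qed.

(** The adjoint of the inclusion is the orthogonal projection. *)
Lemma projP (H : hilbertType R) (V : csubspace H) (x : H) (v : csub V) :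
  inner (cs_val (Defs.proj V x)) (cs_val v) = inner x (cs_val v).
Proof.
have pP : [set P : bop H (csub V) | forall (x : H) (v : csub V),
    inner (x - cs_val (P x)) (cs_val v) = 0] (adj (Defs.incl V)).
  move=> u w /=; rewrite innerBl; apply/eqP; rewrite subr_eq0; apply/eqP.
  exact/esym/(adj_innerl (Defs.incl V)).
apply/esym/eqP; rewrite -subr_eq0 -innerBl; apply/eqP; rewrite /Defs.proj.
by case: xgetP => [P _ h|/(_ _ pP) []//]; exact: h.
Qed.

(** If the adjoints of the [W i] leave the range of an isometry [P] invariant
    and act there as the adjoints of the [S i], then [P] identifies each [S i]
    with the compression of [W i] to that range. *)
Lemma coextension_compression n (H K : hilbertType R) (P : bop H K)
    (S : 'I_n -> bop H H) (W : 'I_n -> bop K K) :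
  isometric P -> (forall i h, adj (W i) (P h) = P (adj (S i) h)) ->
  exists V : csubspace K, cs_set V = range P /\
    unitarily_equivalent S (fun i => compression V (W i)).
Proof.
move=> hP hW.
have r0 : range P 0 by exists 0 => //; rewrite linear0.
have rl (a : R[i]) x y : range P x -> range P y -> range P (a *: x + y).
  by move=> [u _ <-] [v _ <-]; exists (a *: u + v) => //; rewrite linearP.
pose V := CSubspace r0 rl (isometric_range_closed hP).
exists V; split=> //.
have PV h : P h \in cs_pred V by apply/asboolP; exists h.
have Ub : bounded_linear (fun h => CSub (PV h)).
  split; first by move=> a x y; apply: val_inj; rewrite /= linearP.
  by exists 1 => x; rewrite hnorm_csub /= isometric_hnorm ?mul1r.
pose U := mkbop Ub; exists U; split.
- by move=> x y; rewrite -hP.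
- apply/seteqP; split=> // v _; have /asboolP[h _ hv] := cs_valP v.
  by exists h => //; apply: val_inj.
- move=> i; apply: bopP => x; apply: inner_extl => v.
  have /asboolP[y _ hy] := cs_valP v.
  rewrite -[RHS]/(inner (cs_val (Defs.proj V (W i (P x)))) (cs_val v)) projP.
  rewrite -[LHS]/(inner (P (S i x)) (cs_val v)) -hy.
  by rewrite hP (adjP (S i)) (adjP (W i)) hW hP.
Qed.

Lemma adj_dsum (H K : hilbertType R) (S : bop H H) (T : bop K K) :
  adj (dsum S T) = dsum (adj S) (adj T).
Proof.
apply: adj_unique => x y.
rewrite -[LHS]/(inner (S x.1) y.1 + inner (T x.2) y.2).
by rewrite !adjP.
Qed.

End Isometries.

(** * Multiplication operators on the Hardy space *)

Section HardyMultipliers.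
Context {R : realType} {E : hilbertType R}.

Lemma hmon_sqs n (x : E) : sqsummable (fun k => if k == n then x else 0).
Proof.
apply/sqsummableP; exists (hnorm x ^+ 2) => N; rewrite -(big_mkord xpredT
  (fun k => hnorm (if k == n then x else 0 : E) ^+ 2)).
have [nN|Nn] := ltnP n N.
  rewrite (bigD1_seq n) ?mem_index_iota ?iota_uniq //= eqxx big1 ?addr0 //.
  by move=> i /negPf ->; rewrite hnorm0 expr0n.
rewrite big_nat big1 ?exprn_ge0 ?hnorm_ge0 // => i /= iN.
by rewrite ltn_eqF ?hnorm0 ?expr0n // (leq_trans iN).
Qed.

(** The monomial [z ^ n x]. *)
Definition hmon n (x : E) : hardy E := mkhardy (@hmon_sqs n x).

Lemma hmon_inner n x (g : hardy E) : inner (hmon n x) g = inner x (g n).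
Proof.
pose c k : R[i] := inner (hmon n x k) (g k).
have cE (p : R[i] -> R) : p 0 = 0 ->
    series (fun k => p (c k)) @ \oo --> p (inner x (g n)).
  move=> p0; rewrite -(cvg_shiftn n.+1).
  rewrite [X in X @ _ --> _](_ : _ = fun=> p (inner x (g n))).
    exact: cvg_cst.
  apply/funext => m; rewrite /series /= (bigD1_seq n) ?iota_uniq //=; last first.
    by rewrite mem_index_iota /= addnS ltnS leq_addl.
  rewrite /c /= eqxx big1 ?addr0 // => i /negPf ->.
  by rewrite (ip0l inner_productP).
rewrite -[LHS]/(csum c).
by have [_ ->] := csumP (cE (@complex.Re R) erefl) (cE (@complex.Im R) erefl);
   case: (inner _ _).
Qed.

Lemma Mz_hmon n x : Mz (hmon n x) = hmon n.+1 x.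
Proof. by apply: hardyP => -[|k]. Qed.

Lemma Mlin_hmon (A B : bop E E) n x :
  Mlin A B (hmon n x) = hmon n (A x) + hmon n.+1 (B x).
Proof.
have cst (C : bop E E) : Mconst C (hmon n x) = hmon n (C x).
  by apply: hardyP => k /=; case: eqP => //; rewrite linear0.
by rewrite -[LHS]/(Mconst A (hmon n x) + Mz (Mconst B (hmon n x))) !cst Mz_hmon.
Qed.

(** The adjoint of multiplication by [z] is the backward shift. *)
Lemma adj_Mz_coef (g : hardy E) n : adj Mz g n = g n.+1.
Proof. by apply: inner_extr => x; rewrite -!hmon_inner -adjP Mz_hmon. Qed.

Lemma adj_Mlin_coef (A B : bop E E) (g : hardy E) n :
  adj (Mlin A B) g n = adj A (g n) + adj B (g n.+1).
Proof.
apply: inner_extr => x; rewrite -hmon_inner -adjP Mlin_hmon innerDl !hmon_inner.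
by rewrite !adjP innerDr.
Qed.

Lemma Mlin_coef0 (A B : bop E E) (f : hardy E) : Mlin A B f 0%N = A (f 0%N).
Proof. by rewrite -[LHS]/(A (f 0%N) + 0) addr0. Qed.

Lemma Mlin_coefS (A B : bop E E) (f : hardy E) n :
  Mlin A B f n.+1 = A (f n.+1) + B (f n).
Proof. by []. Qed.

(** Commutation of two pencils [A + z B] and [A' + z B'], coefficient by
    coefficient. *)
Lemma Mlin_comm (A B A' B' : bop E E) :
  Mlin A B * Mlin A' B' = Mlin A' B' * Mlin A B ->
  [/\ A * A' = A' * A, B * B' = B' * B & A * B' + B * A' = A' * B + B' * A].
Proof.
move=> h.
have hx x n : Mlin A B (Mlin A' B' (hmon 0 x)) n =
    Mlin A' B' (Mlin A B (hmon 0 x)) n by rewrite -!bop_mulE h.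
split; apply: bopP => x.
- by have := hx x 0%N; rewrite !Mlin_coef0.
- have := hx x 2%N; rewrite !Mlin_coefS /= !linear0 !addr0 !add0r.
  by rewrite !linear0 !add0r.
- by have := hx x 1%N; rewrite !Mlin_coefS !Mlin_coef0 /= !linear0 !add0r.
Qed.

End HardyMultipliers.

Lemma dsum_comm (R : realType) (H K : hilbertType R) (S S' : bop H H)
    (T T' : bop K K) :
  dsum S T * dsum S' T' = dsum S' T' * dsum S T -> S * S' = S' * S.
Proof.
move=> h; apply: bopP => x.
by have /(congr1 (fun F : bop (hsum H K) (hsum H K) => (F (x, 0)).1)) := h.
Qed.

(** * Defect operators and fundamental equations *)

Section Defect.
Context {R : realType} {H : hilbertType R} (D : bop H H).
Hypothesis Dadj : adj D = D.

(** A self-adjoint operator is injective on the closure of its range. *)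
Lemma clrange_inj (y : csub (clrange D)) : D (cs_val y) = 0 -> y = 0.
Proof.
move=> Dy; apply: val_inj; apply: hnorm_le0 => e e0.
have /asboolP := cs_valP y => /closure_hnorm/(_ _ e0)[_ [x _ <-] h].
(* y is orthogonal to the range of D, so its distance to D x is at least |y| *)
have := hnormD_sqr (D x) (- cs_val y).
rewrite innerNr adjP Dadj Dy (ip0r inner_productP) oppr0 mulr0 addr0 hnorm_opp.
move=> E.
apply: le_trans h; rewrite -(@ler_pXn2r _ 2) ?nnegrE ?hnorm_ge0 //.
by rewrite E lerDr exprn_ge0 ?hnorm_ge0.
Qed.

Lemma adj_sandwich (G : bop (csub (clrange D)) (csub (clrange D))) :
  adj (sandwich G) = sandwich (adj G).
Proof.
apply: adj_unique => x y.
rewrite -[LHS]/(inner (D (cs_val (G (cor D x)))) y) adjP Dadj.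
rewrite -[LHS]/(inner (G (cor D x)) (cor D y)) adjP.
by rewrite -[RHS]/(inner x (D (cs_val (adj G (cor D y))))) -(adj_innerl D) Dadj.
Qed.

Variable T : bop H H.
Hypothesis DD : D * D = 1 - T * adj T.

(** Here [D^2 = 1 - T T^*]. Multiplied on the left by [D], which is injective on
    the closure of its range, both sides of the conclusion become
    [D^2 A^*], because
    [(1 - T T^* ) A^* = (A^* - B T^* ) + (B - T A^* ) T^*]; the last bracket is
    the adjoint of [B^* - A T^*], that is [D F'^* D]. *)
Lemma fundamental_intertwining (A B : bop H H)
    (F F' : bop (csub (clrange D)) (csub (clrange D))) :
  A * T = T * A -> adj A - B * adj T = sandwich F ->
  adj B - A * adj T = sandwich F' ->
  forall x, cor D (adj A x) = F (cor D x) + adj F' (cor D (adj T x)).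
Proof.
move=> AT hF hF' x.
have hF'a : B - T * adj A = sandwich (adj F').
  by rewrite -adj_sandwich -hF' adjB adjM !adjK.
have AT' : adj T * adj A = adj A * adj T by rewrite -!adjM AT.
apply/eqP; rewrite -subr_eq0; apply/eqP/clrange_inj.
have -> : D (cs_val (cor D (adj A x) -
      (F (cor D x) + adj F' (cor D (adj T x))))) =
    (D * D) (adj A x) - (sandwich F x + sandwich (adj F') (adj T x)).
  rewrite -[X in D X]/(D (adj A x) - (cs_val (F (cor D x)) +
    cs_val (adj F' (cor D (adj T x))))).
  by rewrite linearB linearD.
rewrite -hF -hF'a -!bop_mulE -!bop_addE -!bop_subE DD.
suff -> : (1 - T * adj T) * adj A -
    (adj A - B * adj T + (B - T * adj A) * adj T) = 0.
  by [].
by rewrite !mulrBl mul1r -!mulrA AT' addrA subrK subrr.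
Qed.

Lemma defect_hnorm x : hnorm (D x) ^+ 2 = hnorm x ^+ 2 - hnorm (adj T x) ^+ 2.
Proof.
rewrite !hnorm_Re adjP Dadj -bop_mulE DD bop_subE bop_mulE innerBr.
by rewrite -(adj_innerl T) raddfB.
Qed.

Lemma defect_telescope h N :
  \sum_(n < N) hnorm (cor D ((adj T ^+ n) h)) ^+ 2 =
    hnorm h ^+ 2 - hnorm ((adj T ^+ N) h) ^+ 2.
Proof.
elim: N => [|N IH]; first by rewrite big_ord0 expr0 subrr.
rewrite big_ord_recr /= IH hnorm_csub /= defect_hnorm -bop_mulE -exprS; lra.
Qed.

End Defect.

(** * The Douglas embedding *)

Section Douglas.
Context {R : realType} {H QQ : hilbertType R} (T D Q : bop H H).
Hypothesis Dadj : adj D = D.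
Hypothesis DD : D * D = 1 - T * adj T.
Hypothesis hQ : asymptotic_limit T Q.
Variable iota : bop (csub (clrange Q)) QQ.
Hypothesis iota_iso : isometric iota.
Local Notation dou := (douglas T D iota).

Lemma adjX n : adj (T ^+ n) = adj T ^+ n.
Proof.
elim: n => [|n IH].
  by rewrite !expr0; apply: adj_unique.
by rewrite exprSr exprS adjM IH.
Qed.

Lemma asymptotic_hnorm h :
  (fun n => hnorm ((adj T ^+ n) h) ^+ 2) @ \oo --> hnorm (Q h) ^+ 2.
Proof.
have [/positive_op_selfadj Qadj /(_ h)/hcvgP hl] := hQ.
apply/cvgrPdist_le => e e0.
have h1 : 0 < hnorm h + 1 by rewrite ltr_wpDl ?hnorm_ge0.
have [N hN] := hl _ (divr_gt0 e0 h1).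
exists N => // n /= /hN {}hN.
have -> : hnorm (Q h) ^+ 2 - hnorm ((adj T ^+ n) h) ^+ 2 =
    complex.Re (inner ((Q * Q) h - (T ^+ n * adj T ^+ n) h) h).
  by rewrite !hnorm_Re innerBl !bop_mulE !adjP adjX Qadj raddfB.
apply: le_trans (Re_inner_le _ _) _.
rewrite [hnorm (_ - _)]/hnorm distrC -/(hnorm _).
apply: le_trans (_ : e / (hnorm h + 1) * (hnorm h + 1) <= _).
  by apply: ler_pM; rewrite ?hnorm_ge0 // lerDl.
by rewrite divfK ?gt_eqF.
Qed.

Lemma douglas_sqs h : sqsummable (fun n => cor D ((adj T ^+ n) h)).
Proof.
apply/sqsummableP; exists (hnorm h ^+ 2) => N.
by rewrite defect_telescope // gerBl exprn_ge0 ?hnorm_ge0.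
Qed.

Lemma douglas_coef h n : (dou h).1 n = cor D ((adj T ^+ n) h).
Proof.
have p : (fun n => cor D ((adj T ^+ n) h)) \in hardy_pred (csub (clrange D)).
  by apply/asboolP; exact: douglas_sqs.
by rewrite /douglas /hardy_of /= /insubd insubT.
Qed.

Lemma douglas_hnorm h : hnorm (dou h) = hnorm h.
Proof.
apply/eqP; rewrite -(@eqrXn2 _ 2) ?hnorm_ge0 //; apply/eqP.
rewrite hsum_hnormE /= isometric_hnorm // hnorm_csub /=.
rewrite [X in X + _]hnorm_Re [inner _ _]hardy_inner_self /=.
rewrite (@cvg_lim _ _ _ _ _ _ (hnorm h ^+ 2 - hnorm (Q h) ^+ 2)) ?subrK //.
rewrite [X in X @ _ --> _](_ : _ =
    (fun n => hnorm h ^+ 2 - hnorm ((adj T ^+ n) h) ^+ 2)).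
  by apply: cvgB; [exact: cvg_cst|exact: asymptotic_hnorm].
apply/funext => n; rewrite /series /= big_mkord -(defect_telescope Dadj DD).
by apply: eq_bigr => i _; rewrite (douglas_coef h).
Qed.

Lemma douglas_linear : linear dou.
Proof.
move=> a x y; rewrite [LHS]surjective_pairing [RHS]surjective_pairing.
congr pair; last first.
  by rewrite -[LHS]/(iota (cor Q (a *: x + y))) !linearP.
apply: hardyP => n.
rewrite -[RHS]/(a *: (dou x).1 n + (dou y).1 n) !douglas_coef.
by rewrite !linearP.
Qed.

Lemma douglas_bounded : bounded_linear dou.
Proof.
by split; [exact: douglas_linear|exists 1 => x; rewrite douglas_hnorm mul1r].
Qed.

(** The Douglas embedding intertwines [S^*] with the adjoint of the pencil
    [F^* + z F'] on the Hardy summand, when [F] and [F'] satisfy the intertwining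
    relation of [fundamental_intertwining]. *)
Lemma douglas_intertwining (S : bop H H) (M : bop QQ QQ)
    (F F' : bop (csub (clrange D)) (csub (clrange D))) :
  S * T = T * S ->
  (forall x, cor D (adj S x) = F (cor D x) + adj F' (cor D (adj T x))) ->
  (forall h, adj M (iota (cor Q h)) = iota (cor Q (adj S h))) ->
  forall h, adj (dsum (Mlin (adj F) F') M) (dou h) = dou (adj S h).
Proof.
move=> ST hF hM h; rewrite adj_dsum.
rewrite [RHS]surjective_pairing; congr pair; last exact: hM.
apply: hardyP => n.
rewrite adj_Mlin_coef adjK !douglas_coef exprS bop_mulE -hF; congr (cor D _).
have : adj S * adj T ^+ n = adj T ^+ n * adj S.
  by apply: commrX; rewrite /GRing.comm -!adjM ST.
by move/(congr1 (fun L : bop H H => L h)).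
Qed.

Lemma douglas_shift (M : bop QQ QQ) :
  (forall h, adj M (iota (cor Q h)) = iota (cor Q (adj T h))) ->
  forall h, adj (dsum Mz M) (dou h) = dou (adj T h).
Proof.
move=> hM h; rewrite adj_dsum.
rewrite [RHS]surjective_pairing; congr pair; last exact: hM.
by apply: hardyP => n; rewrite adj_Mz_coef !douglas_coef exprSr.
Qed.

End Douglas.

(** * Scalars and commutators *)

Section Scaling.
Context {R : realType} {H : hilbertType R}.

Lemma sandwichZ (D : bop H H) (a : R[i])
    (G : bop (csub (clrange D)) (csub (clrange D))) :
  sandwich (a *: G) = a *: sandwich G.
Proof.
by apply: bopP => x; rewrite -[LHS]/(D (a *: cs_val (G (cor D x)))) linearZ.
Qed.

Lemma scale2_adj (A : bop H H) : (2 : R[i]) *: adj A = adj ((2 : R[i]) *: A).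
Proof. by rewrite adjZ rmorph_nat. Qed.

(** Removes the factors 1/2 from the fundamental equations that carry them. *)
Lemma mul_scale2K (A B C : bop H H) X :
  (2^-1 : R[i]) *: A - ((2^-1 : R[i]) *: B) * C = X ->
  A - B * C = (2 : R[i]) *: X.
Proof.
have n2 : (2 : R[i]) != 0 by rewrite pnatr_eq0.
move=> <-; apply: bopP => x; rewrite !(bop_subE, bop_mulE, bop_scaleE) scalerBr.
by rewrite !scalerA divff // !scale1r.
Qed.

Lemma bmul_scaler (a : R[i]) (A B : bop H H) : A * (a *: B) = a *: (A * B).
Proof. by apply: bopP => x; rewrite bop_mulE !bop_scaleE linearZ. Qed.

Lemma bmul_scalel (a : R[i]) (A B : bop H H) : (a *: A) * B = a *: (A * B).
Proof. by apply: bopP. Qed.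

End Scaling.

Section Commutators.
Context {R : realType} {H : hilbertType R}.
Implicit Types A B : bop H H.

Lemma commutatorN A B : - Defs.commutator A B = Defs.commutator B A.
Proof. exact: opprB. Qed.

Lemma commutator_swap A B A' B' :
  Defs.commutator A B = Defs.commutator A' B' ->
  Defs.commutator B A = Defs.commutator B' A'.
Proof. by move=> h; rewrite -(commutatorN A) h commutatorN. Qed.

Lemma adj_commutator A B :
  adj (Defs.commutator A B) = Defs.commutator (adj B) (adj A).
Proof. by rewrite adjB !adjM. Qed.

Lemma commutator_eq0 A B : A * B = B * A -> Defs.commutator A B = 0.
Proof. by move=> h; rewrite /Defs.commutator h subrr. Qed.

Lemma adj_commutator_eq0 A B :
  adj A * adj B = adj B * adj A -> Defs.commutator A B = 0.
Proof. by rewrite -!adjM => /adj_inj/esym/commutator_eq0. Qed.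

(** The shape of the [z]-coefficient in [Mlin_comm]. *)
Lemma cross_commutator A B A' B' :
  A * B' + B * A' = A' * B + B' * A ->
  Defs.commutator A B' = Defs.commutator A' B.
Proof.
move=> h; apply/eqP; rewrite subr_eq addrAC; apply/eqP.
by rewrite -h addrK.
Qed.

End Commutators.

(** * The Douglas model *)

Theorem theorem5p3 (R : realType) (H : hilbertType R)
    (S1 S2 S3 St1 St2 : bop H H)
    (hS : Gamma_contraction (tup5 S1 S2 S3 St1 St2))
    (D : bop H H) (hD : defect_operator (adj S3) D)
    (G1 G2 Gt1 Gt2 : bop (csub (clrange D)) (csub (clrange D)))
    (hG : fundamental_operators S1 S2 S3 St1 St2 G1 G2 Gt1 Gt2)
    (Q : bop H H) (hQ : asymptotic_limit S3 Q)
    (QQ : hilbertType R) (iota : bop (csub (clrange Q)) QQ)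
    (M1 M2 M3 Mt1 Mt2 : bop QQ QQ)
    (hM : canonical_unitary (tup5 S1 S2 S3 St1 St2) iota
            (tup5 M1 M2 M3 Mt1 Mt2)) :
  let W := tup5
    (dsum (Mlin (adj G1) Gt2) M1)
    (dsum (Mlin (2 *: adj G2) (2 *: Gt1)) M2)
    (dsum Mz M3)
    (dsum (Mlin (2 *: adj Gt1) (2 *: G2)) Mt1)
    (dsum (Mlin (adj Gt2) G1) Mt2) in
  (exists HD : csubspace (hsum (hardy (csub (clrange D))) QQ),
     cs_set HD = range (douglas S3 D iota) /\
     unitarily_equivalent (tup5 S1 S2 S3 St1 St2)
       (fun i => compression HD (W i))) /\
  (commuting_tuple W ->
   ([/\ commutator G1 Gt1 = 0, commutator G1 Gt2 = 0,
        commutator G2 Gt1 = 0 & commutator G2 Gt2 = 0] /\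
    (commutator G1 G2 = 0 /\ commutator Gt1 Gt2 = 0)) /\
   [/\ commutator G1 (adj G1) = commutator Gt2 (adj Gt2),
       commutator G2 (adj G2) = commutator Gt1 (adj Gt1) &
       commutator G1 (adj Gt1) = commutator G2 (adj Gt2)] /\
   [/\ commutator Gt1 (adj G1) = commutator Gt2 (adj G2),
       commutator G1 (adj G2) = commutator Gt1 (adj Gt2) &
       commutator (adj G1) G2 = commutator (adj Gt1) Gt2]).
Proof.
move=> W.
have [Sc _] := hS.
have Dadj : adj D = D by case: hD => /positive_op_selfadj.
have DD : D * D = 1 - S3 * adj S3 by case: hD => _ ->; rewrite adjK.
have [iota_iso _ [V [hV hMV]] _] := hM.
have hMS i h : adj (tup5 M1 M2 M3 Mt1 Mt2 i) (iota (cor Q h)) =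
    iota (cor Q (adj (tup5 S1 S2 S3 St1 St2 i) h)) by rewrite hMV hV.
have ST i : tup5 S1 S2 S3 St1 St2 i * S3 = S3 * tup5 S1 S2 S3 St1 St2 i.
  exact: (Sc i 2).
have [hG1 hGt2 hG2 hGt1] := hG.
split.
  have Pb := douglas_bounded Dadj DD hQ iota_iso.
  apply: (@coextension_compression _ _ _ _ (mkbop Pb)).
    by apply: hnorm_isometric => x; exact: douglas_hnorm.
  have dint := @douglas_intertwining _ _ _ _ _ Q Dadj DD iota.
  have fint := fundamental_intertwining Dadj DD.
  move/mul_scale2K: hG2; rewrite -sandwichZ => hG2.
  move/mul_scale2K: hGt1; rewrite -sandwichZ => hGt1.
  case=> [[|[|[|[|[|//]]]]] lti] h.
  - apply: dint (ST 0) _ (hMS 0) h; exact: fint (ST 0) hG1 hGt2.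
  - rewrite /W /tup5 /= scale2_adj.
    apply: dint (ST 1) _ (hMS 1) h; exact: fint (ST 1) hG2 hGt1.
  - exact: (douglas_shift Dadj DD (hMS 2)).
  - rewrite /W /tup5 /= scale2_adj.
    apply: dint (ST 3) _ (hMS 3) h; exact: fint (ST 3) hGt1 hG2.
  - apply: dint (ST 4) _ (hMS 4) h; exact: fint (ST 4) hGt2 hG1.
(* the six pairs of entries other than the shift repeat each other up to
   adjoints: four of them suffice *)
move=> Wc.
have n2 : (2 : R[i]) != 0 by rewrite pnatr_eq0.
have [] := Mlin_comm (dsum_comm (Wc 0 1)).
rewrite !(bmul_scaler, bmul_scalel) -!scalerDr.
move=> /(scalerI n2)/adj_commutator_eq0 c12 /(scalerI n2)/esym/commutator_eq0 ct12.
move=> /(scalerI n2)/cross_commutator x12.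
have [] := Mlin_comm (dsum_comm (Wc 0 3)).
rewrite !(bmul_scaler, bmul_scalel) -!scalerDr.
move=> /(scalerI n2)/adj_commutator_eq0 c11 /(scalerI n2)/esym/commutator_eq0 c22.
move=> /(scalerI n2)/cross_commutator x11.
have [/adj_commutator_eq0 c1t2 _ /cross_commutator x1t2] :=
  Mlin_comm (dsum_comm (Wc 0 4)).
have [] := Mlin_comm (dsum_comm (Wc 1 3)).
rewrite !(bmul_scaler, bmul_scalel) -!scalerDr.
move=> /(scalerI n2)/(scalerI n2)/adj_commutator_eq0 c21 _.
move=> /(scalerI n2)/(scalerI n2)/cross_commutator x21.
have := congr1 adj x12; rewrite !adj_commutator !adjK => y12.
have := congr1 adj x11; rewrite !adj_commutator !adjK => y11.
do !split=> //; exact: commutator_swap.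
Qed.
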